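(* As $\varepsilon\to0$, the minimal numbers of function values needed to approximate the smallest eigenvalue $\lambda(q)$ over $q\in\mathbf{Q}$ with error at most $\varepsilon$ in the worst case and randomized settings satisfy $$n^{\mathrm{wor}}(\varepsilon)=\Omega\left(\varepsilon^{-1/2}\right),\qquad n^{\mathrm{ran}}(\varepsilon)=\Omega\left(\varepsilon^{-2/5}\right).$$
   Context: $\mathbf{Q}$ is the class of functions $q:[0,1]\to[0,1]$ with $q\in C^2([0,1])$ and $\max_{i=0,1,2}\max_{x\in[0,1]}|q^{(i)}(x)|\le 1$. For $q\in\mathbf{Q}$, $\lambda(q)$ is the smallest eigenvalue of $-u''+qu=\lambda u$ on $(0,1)$, $u(0)=u(1)=0$. Deterministic algorithms: $\phi(q)=\phi(q(t_1),\dots,q(t_{n_q}))$, based on values of $q$ at points $t_i\in[0,1]$ that may be chosen adaptively, $t_i=t_i(t_1,q(t_1),\dots,t_{i-1},q(t_{i-1}))$ for $i\ge2$; the number $n_q$ may also be chosen adaptively. Let $n=\sup_{q\in\mathbf{Q}}n_q$, assumed finite. The worst case error is $e^{\mathrm{wor}}(\phi,n)=\sup_{q\in\mathbf{Q}}|\lambda(q)-\phi(q)|$. Randomized algorithms: $\phi_\omega(q)=\phi_\omega(q(t_{1,\omega}),\dots,q(t_{n_{q,\omega},\omega}))$, where $\omega$ is a random element, $t_{i,\omega}=t_i(t_{1,\omega},q(t_{1,\omega}),\dots,t_{i-1,\omega},q(t_{i-1,\omega}))$ may be adaptive, and the mappings $\omega\mapsto t_{i,\omega}$, $\omega\mapsto\phi_\omega$,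 $\omega\mapsto n_{q,\omega}$ are measurable. Let $n_q=\mathbb{E}(n_{q,\omega})$ and $n=\sup_{q\in\mathbf{Q}}n_q$, assumed finite. The randomized error is $e^{\mathrm{ran}}(\phi,n)=\sup_{q\in\mathbf{Q}}\left(\mathbb{E}[\lambda(q)-\phi_\omega(q)]^2\right)^{1/2}$. $n^{\mathrm{wor}}(\varepsilon)=\min\{n:\exists\,\phi\text{ deterministic with }e^{\mathrm{wor}}(\phi,n)\le\varepsilon\}$ and $n^{\mathrm{ran}}(\varepsilon)=\min\{n:\exists\,\phi\text{ randomized with }e^{\mathrm{ran}}(\phi,n)\le\varepsilon\}$. *)

(* Defs.v *)
From HB Require Import structures.
From mathcomp Require Import all_boot all_order all_algebra.
From mathcomp Require Import all_classical all_reals all_analysis.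

Set Implicit Arguments.
Unset Strict Implicit.
Unset Printing Implicit Defensive.

Import Order.TTheory GRing.Theory Num.Theory.
Import numFieldNormedType.Exports.

Local Open Scope classical_set_scope.
Local Open Scope ring_scope.

Definition I01 (R : realType) : set R := `[0, 1].

(* Functions on [0,1] are represented by functions on R whose values outside
   [0,1] are irrelevant; derivatives at 0 and 1 are one-sided. *)
Definition is_deriv01 (R : realType) (f g : R -> R) : Prop :=
  forall x, I01 x -> (f y - f x) / (y - x) @[y --> within (@I01 R) x^'] --> g x.

Definition is_C2 (R : realType) (f f1 f2 : R -> R) : Prop :=
  [/\ is_deriv01 f f1, is_deriv01 f1 f2 & {within (@I01 R), continuous f2}].

Definition classQ (R : realType) : set (R -> R) :=
  [set q | exists q1 q2, is_C2 q q1 q2 /\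
    forall x, I01 x -> [/\ 0 <= q x <= 1, `|q1 x| <= 1 & `|q2 x| <= 1]].

Definition eigenvalue (R : realType) (q : R -> R) (l : R) : Prop :=
  exists u u1 u2 : R -> R,
    [/\ is_C2 u u1 u2, u 0 = 0, u 1 = 0, exists2 x, I01 x & u x != 0
      & forall x, 0 < x < 1 -> - u2 x + q x * u x = l * u x].

Definition smallest_eigenvalue (R : realType) (q : R -> R) (l : R) : Prop :=
  eigenvalue q l /\ forall m, eigenvalue q m -> l <= m.

(* The default value 0 is not used for q in classQ, which always has a smallest
   eigenvalue. *)
Definition lambda (R : realType) (q : R -> R) : R :=
  xget 0 [set l | smallest_eigenvalue q l].

(* A history [:: (t_1, q t_1); ...; (t_i, q t_i)]. *)
Fixpoint history (R : realType) (point : seq (R * R) -> R) (q : R -> R)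
    (i : nat) : seq (R * R) :=
  if i is j.+1 then
    let h := history point q j in rcons h (point h, q (point h))
  else [::].

(* [stop] decides adaptively, from the information gathered so far, whether
   to stop sampling; [output] sees the list of computed values. *)
Record algorithm (R : realType) := Algorithm {
  point : seq (R * R) -> R ;
  stop : seq (R * R) -> bool ;
  output : seq R -> R ;
  point_I01 : forall h, I01 (point h) ;
  stopP : forall q, classQ q -> exists i, stop (history point q i)
}.

Section Runs.
Context (R : realType) (A : algorithm R) (q : R -> R).

(* The default value 0 of [xget] is not used for q in classQ, by [stopP]. *)
Definition nvalues : nat :=
  xget 0%N [set n | stop A (history (point A) q n) /\
                    forall m, (m < n)%N -> ~~ stop A (history (point A) q m)].

(* Indices are shifted: [node i] is t_{i+1}. *)
Definition node (i : nat) : R := point A (history (point A) q i).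

Definition answer : R :=
  output A [seq p.2 | p <- history (point A) q nvalues].

End Runs.

Section WorstCase.
Context (R : realType).
Local Open Scope ereal_scope.

Definition cost_wor (A : algorithm R) : \bar R :=
  ereal_sup [set (nvalues A q)%:R%:E | q in @classQ R].

Definition err_wor (A : algorithm R) : \bar R :=
  ereal_sup [set `|lambda q - answer A q|%:E | q in @classQ R].

(* The minimum over the empty set is +oo. *)
Definition n_wor (eps : R) : \bar R :=
  ereal_inf [set cost_wor A | A in
    [set A : algorithm R | cost_wor A < +oo /\ err_wor A <= eps%:E]].

End WorstCase.

(* The random maps t_i, phi and n_q are measurable for each fixed q; t_i is
   only constrained where it is actually used, i.e. where i <= n_q. *)
Record ran_algorithm (R : realType) d (T : measurableType d) := RanAlgorithm {
  ran_alg :> T -> algorithm R ;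
  measurable_nvalues : forall q, classQ q ->
    measurable_fun [set: T] (fun w => nvalues (ran_alg w) q) ;
  measurable_node : forall q i, classQ q ->
    measurable_fun [set w | (i < nvalues (ran_alg w) q)%N]
                   (fun w => node (ran_alg w) q i) ;
  measurable_answer : forall q, classQ q ->
    measurable_fun [set: T] (fun w => answer (ran_alg w) q)
}.

Section Randomized.
Context (R : realType).
Local Open Scope ereal_scope.

Section Algorithm.
Context d (T : measurableType d) (P : probability T R) (A : ran_algorithm R T).

Definition cost_ran : \bar R :=
  ereal_sup [set 'E_P[fun w => (nvalues (A w) q)%:R%R] | q in @classQ R].

Definition err_ran : \bar R :=
  ereal_sup [set 'E_P[fun w => ((lambda q - answer (A w) q) ^+ 2)%R] `^ 2^-1
            | q in @classQ R].

End Algorithm.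

(* Expected costs are real numbers, so the "minimal" cost is an infimum; it
   ranges over all algorithms on all probability spaces. *)
Definition n_ran (eps : R) : \bar R :=
  ereal_inf [set c | exists (d : measure_display) (T : measurableType d)
    (P : probability T R) (A : ran_algorithm R T),
    [/\ cost_ran P A < +oo, err_ran P A <= eps%:E & c = cost_ran P A]].

End Randomized.

(* f(eps) = Omega(g(eps)) as eps tends to 0 from the right; the library's
   Omega does not cover extended-real-valued f. *)
Definition Omega_0 (R : realType) (f : R -> \bar R) (g : R -> R) : Prop :=
  exists2 c : R, 0 < c & \forall eps \near 0^'+, ((c * g eps)%:E <= f eps)%E.

(* Main.v *)
(** Fooling potentials.  Put N disjoint C^2 bumps of width h = 1/(2N) and
    height of order h^2 in the middle half of [0,1]; every sum of 1/2 and of a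
    subset J of them lies in the class.  An eigenfunction of such a potential
    close to sin(pi x), together with its eigenvalue, is obtained as a fixed
    point of a contraction; being positive, it belongs to the smallest
    eigenvalue.  Comparing two such eigenfunctions through their Wronskian,
    adding one bump raises the smallest eigenvalue by at least gap ~ h^3.

    Worst case: an algorithm using at most N/2 values on the constant potential
    1/2 misses N/2 bumps, and cannot tell it from a potential whose eigenvalue
    is larger by N gap / 2 ~ N^-2.

    Randomized case: average over all subsets J.  For a deterministic algorithm
    the bumps it has not visited remain independent fair coins, each of
    influence at least gap, so that the mean square error is at least
    gap^2/4 times the mean number of unvisited bumps, that is of order N^-5
    unless the mean cost is of order N.  This bound is linear in the cost, and
    may be integrated over the randomness of the algorithm. *)
Require Import Defs.
From mathcomp Require Import all_boot all_order all_algebra.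
From mathcomp Require Import all_classical all_reals all_analysis.
From mathcomp Require Import measurable_realfun ring lra.

Set Implicit Arguments.
Unset Strict Implicit.
Unset Printing Implicit Defensive.

Import Order.TTheory GRing.Theory Num.Theory.
Import numFieldNormedType.Exports.

Local Open Scope classical_set_scope.
Local Open Scope ring_scope.

(** * Derivatives and antiderivatives *)

Section Calculus.
Context {R : realType}.
Implicit Types (f g F G : R -> R) (x y a b M : R).

Lemma is_derive1_cst c x : is_derive x 1 (fun=> c : R) (0 : R).
Proof. exact: is_derive_cst. Qed.

Lemma is_derive1_id x : is_derive x 1 (fun y : R => y) (1 : R).
Proof. exact: is_derive_id. Qed.

Lemma is_derive1_add f g x (df dg : R) : is_derive x 1 f df ->
  is_derive x 1 g dg -> is_derive x 1 (fun y => f y + g y) (df + dg).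
Proof. exact: is_deriveD. Qed.

Lemma is_derive1_sub f g x (df dg : R) : is_derive x 1 f df ->
  is_derive x 1 g dg -> is_derive x 1 (fun y => f y - g y) (df - dg).
Proof. exact: is_deriveB. Qed.

Lemma is_derive1_mul f g x (df dg : R) : is_derive x 1 f df ->
  is_derive x 1 g dg -> is_derive x 1 (fun y => f y * g y) (df * g x + f x * dg).
Proof.
move=> dF dG; rewrite addrC [df * _]mulrC.
exact: (is_deriveM dF dG).
Qed.

Lemma is_derive1_scale c f x (df : R) : is_derive x 1 f df ->
  is_derive x 1 (fun y => c * f y) (c * df).
Proof. exact: is_deriveZ. Qed.

Lemma is_derive_continuous F x d : is_derive x 1 F d -> {for x, continuous F}.
Proof. by move=> [dF _]; exact/differentiable_continuous/derivable1_diffP. Qed.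

Lemma ge_increment F f a b M : a <= b ->
  (forall x, a < x < b -> is_derive x 1 F (f x)) ->
  {within `[a, b], continuous F} -> (forall x, a < x < b -> M <= f x) ->
  M * (b - a) <= F b - F a.
Proof.
rewrite le_eqVlt => /predU1P[-> _ _ _|ab dF cF Mf]; first by rewrite !subrr mulr0.
have dF' x : x \in `]a, b[ -> is_derive x 1 F (f x) by rewrite in_itv; exact: dF.
have [c + ->] := MVT ab dF' cF; rewrite in_itv /= => /Mf Mfc.
by rewrite ler_wpM2r// subr_ge0 ltW.
Qed.

Lemma le_increment F f a b M : a <= b ->
  (forall x, a < x < b -> is_derive x 1 F (f x)) ->
  {within `[a, b], continuous F} -> (forall x, a < x < b -> f x <= M) ->
  F b - F a <= M * (b - a).
Proof.
rewrite le_eqVlt => /predU1P[-> _ _ _|ab dF cF Mf]; first by rewrite !subrr mulr0.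
have dF' x : x \in `]a, b[ -> is_derive x 1 F (f x) by rewrite in_itv; exact: dF.
have [c + ->] := MVT ab dF' cF; rewrite in_itv /= => /Mf Mfc.
by rewrite ler_wpM2r// subr_ge0 ltW.
Qed.

(** Integrating from -1 puts 0 inside the interval of the fundamental theorem, so that the
    derivative at 0 is two-sided; subtracting [F 0] normalizes. *)
Lemma primitive_right g : continuous g ->
  exists2 G, G 0 = 0 & forall x, -1 < x -> is_derive x 1 G (g x).
Proof.
move=> cg; pose F x := (\int[lebesgue_measure]_(t in `[(-1:R), x]) g t)%R.
exists (fun x => F x - F 0); first by rewrite subrr.
move=> x x1; have [dF F'] : derivable F x 1 /\ derive1 F x = g x.
  apply: (@continuous_FTC1_closed _ g (-1) x (x + 1)) => //; first by rewrite ltrDl.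
  apply: continuous_compact_integrable; first exact: segment_compact.
    by apply: continuous_subspaceT => y; exact: cg.
  exact: cg.
have dF' : is_derive x 1 F (g x) by apply: DeriveDef; [exact: dF|rewrite -F' derive1E].
by apply: is_derive_eq; rewrite subr0.
Qed.

(** The left half reflects the primitive of [g \o -%R]. Both halves are differentiable across 0 and
    agree on ]-1, 1[, where their difference has derivative zero, so gluing at 0 keeps the
    derivative. *)
Lemma primitive g : continuous g ->
  exists G, G 0 = 0 /\ forall x, is_derive x 1 G (g x).
Proof.
move=> cg; have [G G0 dG] := primitive_right cg.
have [H H0 dH] : exists2 G, G 0 = 0 &
    forall x, -1 < x -> is_derive x 1 G (g (- x)).
  apply: (@primitive_right (g \o -%R)) => x.
  by apply: continuous_comp; [exact: opp_continuous|exact: cg].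
have dHN x : x < 1 -> is_derive x 1 (fun y => - H (- y)) (g x).
  move=> x1; have dHx : is_derive (- x) 1 H (g x).
    by rewrite -[in g _](opprK x); apply: dH; rewrite ltrN2.
  have dN : is_derive x 1 (-%R : R -> R) (-1) by exact: is_deriveNid.
  have := is_deriveN (is_derive1_comp dHx dN).
  by rewrite mulrN1 opprK.
have GH x : -1 < x < 1 -> G x = - H (- x).
  move=> /andP[x1 x2].
  pose D y := G y - (- H (- y)).
  have dD y : -1 < y < 1 -> is_derive y 1 D 0.
    move=> /andP[y1 y2]; by rewrite -(subrr (g y)); apply: is_deriveB; [exact: dG|exact: dHN].
  have cD a b : -1 < a -> b < 1 -> {within `[a, b], continuous D}.
    move=> a1 b1; apply: continuous_in_subspaceT => y.
    rewrite inE/= in_itv/= => /andP[ay yb].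
    by apply: is_derive_continuous; apply: dD; rewrite (lt_le_trans a1 ay) (le_lt_trans yb b1).
  have D0 : D 0 = 0 by rewrite /D G0 oppr0 H0 !oppr0 addr0.
  suff : D x = 0 by move/eqP; rewrite subr_eq0 => /eqP.
  have dab a b y : -1 < a -> b < 1 -> a < y < b -> is_derive y 1 D 0.
    move=> a1 b1 /andP[ay yb]; apply: dD; lra.
  have [x0|/ltW x0] := leP 0 x.
    apply/eqP; rewrite eq_le; apply/andP; split.
      have := @le_increment D (fun=> 0) 0 x 0 x0.
      rewrite D0 !subr0 mul0r; apply => //; first by move=> y; apply: dab.
      by apply: cD.
    have := @ge_increment D (fun=> 0) 0 x 0 x0.
    rewrite D0 !subr0 mul0r; apply => //; first by move=> y; apply: dab.
    by apply: cD.
  apply/eqP; rewrite -oppr_eq0 eq_le; apply/andP; split.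
    have := @le_increment D (fun=> 0) x 0 0 x0.
    rewrite D0 !sub0r mul0r; apply => //; first by move=> y; apply: dab.
    by apply: cD.
  have := @ge_increment D (fun=> 0) x 0 0 x0.
  rewrite D0 !sub0r mul0r; apply => //; first by move=> y; apply: dab.
  by apply: cD.
exists (fun x => if x < 0 then - H (- x) else G x); split; first by rewrite ltxx.
move=> x; have [x0|x0] := ltP x 1.
  apply: (near_eq_is_derive _ (dHN x x0)).
  near=> y; case: ltP => // y0; apply: esym; apply: GH.
  have -> /= : -1 < y by lra.
  by near: y; apply: lt_nbhsl.
have x1 : -1 < x by lra.
apply: (near_eq_is_derive _ (dG x x1)).
near=> y; case: ltP => // y0.
suff : 0 < y by lra.
by near: y; apply: lt_nbhsr; lra.
Unshelve. all: by end_near. Qed.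

End Calculus.

(** * One-sided derivatives and Wronskians *)

Section OneSided.
Context {R : realType}.
Implicit Types (f g u v q : R -> R) (x y a b : R).

Lemma I01E x : I01 x = (0 <= x <= 1) :> Prop.
Proof. by rewrite /I01/= in_itv. Qed.

Lemma is_derive_deriv01 f g :
  (forall x, I01 x -> is_derive x 1 f (g x)) -> is_deriv01 f g.
Proof.
move=> df x Ix; have [h [fE ch <-]] := (is_derive1_caratheodory f x (g x)).1 (df x Ix).
have hx : h y @[y --> within (@I01 R) x^'] --> h x.
  by apply: cvg_trans ch; apply: cvg_app => P nP; apply: cvg_within; exact: cvg_within.
apply: cvg_trans hx; apply: near_eq_cvg; near=> y.
have yx : y != x by near: y; apply: (cvg_within _ (nbhs_dnbhs_neq x)).
by rewrite fE mulfK// subr_eq0.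
Unshelve. all: by end_near. Qed.

(** The difference quotient cleared of its denominator: this form also covers [y = x] and serves the
    one-sided derivatives at 0 and 1. *)
Lemma is_deriv01_dist f g x e : is_deriv01 f g -> I01 x -> 0 < e ->
  exists2 d, 0 < d & forall y, I01 y -> `|y - x| < d ->
    `|f y - f x - g x * (y - x)| <= e * `|y - x|.
Proof.
move=> df Ix e0; have /cvgrPdist_le/(_ e e0) := df x Ix.
rewrite near_withinE near_withinE => /nbhs_ballP[d /= d0 H].
exists d => // y Iy yd; have [->|yx] := eqVneq y x.
  by rewrite !subrr mulr0 subrr normr0 mulr0.
have := H y; rewrite /ball/= distrC => /(_ yd yx Iy).
have yx0 : y - x != 0 by rewrite subr_eq0.
have -> : g x - (f y - f x) / (y - x) = - ((f y - f x - g x * (y - x)) / (y - x)).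
  by field.
by rewrite normrN normrM normfV ler_pdivrMr// normr_gt0.
Qed.

Lemma deriv01_is_derive f g x : is_deriv01 f g -> 0 < x < 1 -> is_derive x 1 f (g x).
Proof.
move=> df /andP[x0 x1]; have Ix : I01 x by rewrite I01E; lra.
pose h y := if y == x then g x else (f y - f x) / (y - x).
apply/is_derive1_caratheodory; exists h; split; last by rewrite /h eqxx.
  move=> y; rewrite /h; case: eqVneq => [->|yx]; first by rewrite !subrr mulr0.
  by rewrite divfK// subr_eq0.
apply/cvgrPdist_le => e e0; have [d d0 H] := is_deriv01_dist df Ix e0.
near=> y; rewrite /h eqxx; case: eqVneq => [_|yx]; first by rewrite subrr normr0 ltW.
have yx0 : y - x != 0 by rewrite subr_eq0.
have -> : g x - (f y - f x) / (y - x) = - ((f y - f x - g x * (y - x)) / (y - x)).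
  by field.
rewrite normrN normrM normfV ler_pdivrMr ?normr_gt0//; apply: H.
  rewrite I01E; apply/andP; split; apply: ltW; near: y; [exact: lt_nbhsr|exact: lt_nbhsl].
rewrite distrC; near: y; exact: (nbhsx_ballx x d d0).
Unshelve. all: by end_near. Qed.

Lemma deriv01_continuous f g : is_deriv01 f g -> {within (@I01 R), continuous f}.
Proof.
move=> df; apply/subspace_continuousP => x Ix; apply/cvgrPdist_le => e e0.
have [d d0 H] := is_deriv01_dist df Ix ltr01.
rewrite near_withinE; near=> y => Iy.
have yd : `|y - x| < d by rewrite distrC; near: y; exact: (nbhsx_ballx x d d0).
have gx0 : 0 < 1 + `|g x| by rewrite ltr_pwDl.
have ye : `|y - x| < e / (1 + `|g x|).
  by rewrite distrC; near: y; apply: (nbhsx_ballx x); rewrite divr_gt0.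
have := H y Iy yd; rewrite mul1r => fy.
have -> : f x - f y = - ((f y - f x - g x * (y - x)) + g x * (y - x)) by ring.
rewrite normrN (le_trans (ler_normD _ _))// normrM.
move: ye; rewrite ltr_pdivlMr//; nra.
Unshelve. all: by end_near. Qed.

Lemma continuous_I01_dist f x e : {within (@I01 R), continuous f} -> I01 x -> 0 < e ->
  exists2 d, 0 < d & forall y, I01 y -> `|y - x| < d -> `|f y - f x| <= e.
Proof.
move=> /subspace_continuousP/(_ x) cf Ix e0.
have /cvgrPdist_le/(_ e e0) := cf Ix.
rewrite near_withinE => /nbhs_ballP[d /= d0 H].
exists d => // y Iy yd; rewrite distrC; apply: H => //.
by rewrite /ball/= distrC.
Qed.

Definition wronskian u u1 v v1 x : R := u x * v1 x - v x * u1 x.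

Lemma wronskian_derive u u1 u2 v v1 v2 x : is_C2 u u1 u2 -> is_C2 v v1 v2 ->
  0 < x < 1 -> is_derive x 1 (wronskian u u1 v v1) (u x * v2 x - v x * u2 x).
Proof.
move=> [du du1 _] [dv dv1 _] x01.
have := is_derive1_sub (is_derive1_mul (deriv01_is_derive du x01) (deriv01_is_derive dv1 x01))
  (is_derive1_mul (deriv01_is_derive dv x01) (deriv01_is_derive du1 x01)).
by congr is_derive; ring.
Qed.

Lemma wronskian_continuous u u1 u2 v v1 v2 : is_C2 u u1 u2 -> is_C2 v v1 v2 ->
  {within (@I01 R), continuous (wronskian u u1 v v1)}.
Proof.
move=> [du du1 _] [dv dv1 _] x.
by apply: cvgB; apply: cvgM; apply: (deriv01_continuous _) => //; eassumption.
Qed.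

End OneSided.

(** * Positive eigenfunctions *)

Section Sturm.
Context {R : realType}.
Implicit Types (f g u v q : R -> R) (x y a b l m : R).

(** A negative slope at the zero [a], with tolerance half its size in the first-order expansion,
    would make [v] negative just to the right of [a]. *)
Lemma deriv01_right_ge0 v v1 a b : is_deriv01 v v1 -> 0 <= a -> a < b -> b <= 1 ->
  v a = 0 -> (forall y, a < y < b -> 0 <= v y) -> 0 <= v1 a.
Proof.
move=> dv a0 ab b1 va vpos; rewrite leNgt; apply/negP => v1a.
have e0 : 0 < - v1 a / 2 by lra.
have Ia : I01 a by rewrite I01E; lra.
have [d d0 H] := is_deriv01_dist dv Ia e0.
pose t := Num.min d (b - a) / 2.
have [t0 td tb] : [/\ 0 < t, t < d & t < b - a].
  by rewrite /t; case: (leP d (b - a)); split; lra.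
have Iy : I01 (a + t) by rewrite I01E; lra.
have := H _ Iy; rewrite addrAC subrr add0r gtr0_norm// => /(_ td).
rewrite va subr0 ler_norml => /andP[_].
have : 0 <= v (a + t) by apply: vpos; lra.
nra.
Qed.

Lemma deriv01_left_le0 v v1 a b : is_deriv01 v v1 -> 0 <= a -> a < b -> b <= 1 ->
  v b = 0 -> (forall y, a < y < b -> 0 <= v y) -> v1 b <= 0.
Proof.
move=> dv a0 ab b1 vb vpos; rewrite leNgt; apply/negP => v1b.
have e0 : 0 < v1 b / 2 by lra.
have Ib : I01 b by rewrite I01E; lra.
have [d d0 H] := is_deriv01_dist dv Ib e0.
pose t := Num.min d (b - a) / 2.
have [t0 td tb] : [/\ 0 < t, t < d & t < b - a].
  by rewrite /t; case: (leP d (b - a)); split; lra.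
have Iy : I01 (b - t) by rewrite I01E; lra.
have := H _ Iy; rewrite addrAC subrr add0r normrN gtr0_norm// => /(_ td).
rewrite vb subr0 ler_norml => /andP[_].
have : 0 <= v (b - t) by apply: vpos; lra.
nra.
Qed.

(** The zero is the supremum of the points of [0, x] where [v <= 0]; continuity rules out both signs
    of [v] there. With the mirror image below it yields the nodal interval of [v] around [x]. *)
Lemma last_zero_before v x : {within (@I01 R), continuous v} -> v 0 = 0 ->
  I01 x -> 0 < v x ->
  exists a, [/\ 0 <= a, a < x, v a = 0 & forall y, a < y <= x -> 0 < v y].
Proof.
move=> cv v0 Ix vx; move: (Ix); rewrite I01E => /andP[x0 x1].
pose Z := [set y | 0 <= y <= x /\ v y <= 0].
have Z0 : Z 0 by rewrite /Z/= v0 lexx.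
have ubZ : ubound Z x by move=> y [/andP[]].
have supZ : has_sup Z by split; [exists 0 | exists x].
pose a := sup Z.
have a0 : 0 <= a by apply: ub_le_sup => //; exists x.
have ax : a <= x by apply: ge_sup => //; exists 0.
have Ia : I01 a by rewrite I01E; lra.
have after y : a < y <= x -> 0 < v y.
  move=> /andP[ay yx]; rewrite ltNge; apply/negP => vy.
  suff : y <= a by lra.
  by apply: ub_le_sup; [exists x|split => //; lra].
have va : v a <= 0.
  rewrite leNgt; apply/negP => va.
  have va2 : 0 < v a / 2 by lra.
  have [d d0 H] := continuous_I01_dist cv Ia va2.
  have [y [/andP[y0 yx] vy] ay] := sup_adherent d0 supZ.
  have ya : y <= a by apply: ub_le_sup; [exists x|split => //; lra].
  have Iy : I01 y by rewrite I01E; lra.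
  have := H y Iy; rewrite ler0_norm; last lra.
  have yd : - (y - a) < d by rewrite -/a in ay; lra.
  by move=> /(_ yd); rewrite ler_norml => /andP[+ _]; lra.
have ax' : a < x.
  by rewrite lt_neqAle ax andbT; apply/eqP => axE; move: va; rewrite axE; lra.
exists a; split => //; apply/eqP; rewrite eq_le va/= leNgt; apply/negP => va'.
have va2 : 0 < - v a / 2 by lra.
have [d d0 H] := continuous_I01_dist cv Ia va2.
pose t := Num.min d (x - a) / 2.
have [t0 td tb] : [/\ 0 < t, t < d & t < x - a].
  by rewrite /t; case: (leP d (x - a)); split; lra.
have Iy : I01 (a + t) by rewrite I01E; lra.
have := H _ Iy; rewrite addrAC subrr add0r gtr0_norm// => /(_ td).
have : 0 < v (a + t) by apply: after; lra.
by rewrite ler_norml => + /andP[_ +]; lra.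
Qed.

Lemma first_zero_after v x : {within (@I01 R), continuous v} -> v 1 = 0 ->
  I01 x -> 0 < v x ->
  exists b, [/\ b <= 1, x < b, v b = 0 & forall y, x <= y < b -> 0 < v y].
Proof.
move=> cv v1 Ix vx; move: (Ix); rewrite I01E => /andP[x0 x1].
pose Z := [set y | x <= y <= 1 /\ v y <= 0].
have Z1 : Z 1 by rewrite /Z/= v1 !lexx andbT.
have lbZ : lbound Z x by move=> y [/andP[]].
have infZ : has_inf Z by split; [exists 1 | exists x].
pose b := inf Z.
have b1 : b <= 1 by apply: ge_inf => //; exists x.
have bx : x <= b by apply: lb_le_inf => //; exists 1.
have Ib : I01 b by rewrite I01E; lra.
have before y : x <= y < b -> 0 < v y.
  move=> /andP[xy yb]; rewrite ltNge; apply/negP => vy.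
  suff : b <= y by lra.
  by apply: ge_inf; [exists x|split => //; lra].
have vb : v b <= 0.
  rewrite leNgt; apply/negP => vb.
  have vb2 : 0 < v b / 2 by lra.
  have [d d0 H] := continuous_I01_dist cv Ib vb2.
  have [y [/andP[y0 yx] vy] ay] := inf_adherent d0 infZ.
  have yb : b <= y by apply: ge_inf; [exists x|split => //; lra].
  have Iy : I01 y by rewrite I01E; lra.
  have := H y Iy; rewrite ger0_norm; last lra.
  have yd : y - b < d by rewrite -/b in ay; lra.
  by move=> /(_ yd); rewrite ler_norml => /andP[+ _]; lra.
have bx' : x < b.
  by rewrite lt_neqAle bx andbT; apply/eqP => bxE; move: vb; rewrite -bxE; lra.
exists b; split => //; apply/eqP; rewrite eq_le vb/= leNgt; apply/negP => vb'.
have vb2 : 0 < - v b / 2 by lra.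
have [d d0 H] := continuous_I01_dist cv Ib vb2.
pose t := Num.min d (b - x) / 2.
have [t0 td tb] : [/\ 0 < t, t < d & t < b - x].
  by rewrite /t; case: (leP d (b - x)); split; lra.
have Iy : I01 (b - t) by rewrite I01E; lra.
have := H _ Iy; rewrite addrAC subrr add0r normrN gtr0_norm// => /(_ td).
have : 0 < v (b - t) by apply: before; lra.
by rewrite ler_norml => + /andP[_ +]; lra.
Qed.

Lemma is_deriv01N f g : is_deriv01 f g -> is_deriv01 (- f) (- g).
Proof.
move=> df x Ix; have := cvgN (df x Ix).
have -> : (- (fun y => (f y - f x) / (y - x)) : R -> R) =
    (fun y => ((- f) y - (- f) x) / (y - x)).
  by apply/funext => y; rewrite !fctE -mulNr; congr (_ / _); ring.
exact.
Qed.

Lemma is_C2N u u1 u2 : is_C2 u u1 u2 -> is_C2 (- u) (- u1) (- u2).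
Proof.
move=> [du du1 cu2]; split; [exact: is_deriv01N|exact: is_deriv01N|].
apply/subspace_continuousP => x Ix; apply: cvgN.
by move/subspace_continuousP: cu2; exact.
Qed.

Section Comparison.
Variables (q : R -> R) (l : R) (u u1 u2 : R -> R).
Hypothesis uC2 : is_C2 u u1 u2.
Hypothesis u0 : u 0 = 0.
Hypothesis u1E : u 1 = 0.
Hypothesis upos : forall x, 0 < x < 1 -> 0 < u x.
Hypothesis uE : forall x, 0 < x < 1 -> - u2 x + q x * u x = l * u x.

Lemma positive_eigenfunction_ge0 x : I01 x -> 0 <= u x.
Proof.
rewrite I01E => /andP[]; rewrite le_eqVlt => /predU1P[<-|x0]; first by rewrite u0.
rewrite le_eqVlt => /predU1P[->|x1]; first by rewrite u1E.
by apply/ltW/upos; rewrite x0.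
Qed.

(* On a nodal interval of v the Wronskian of u and v would increase strictly,
   while its boundary values are nonnegative at the left end and nonpositive
   at the right end. *)
Lemma eigenvalue_lt_no_positive_value m v v1 v2 x : m < l -> is_C2 v v1 v2 ->
  v 0 = 0 -> v 1 = 0 -> I01 x ->
  (forall y, 0 < y < 1 -> - v2 y + q y * v y = m * v y) -> v x <= 0.
Proof.
move=> ml vC2 v0 v1E Ix vE; rewrite leNgt; apply/negP => vx.
have [dv dv1 _] := vC2; have cv := deriv01_continuous dv.
have [a [a0 ax va apos]] := last_zero_before cv v0 Ix vx.
have [b [b1 xb vb bpos]] := first_zero_after cv v1E Ix vx.
have ab : a < b by lra.
have vpos y : a < y < b -> 0 < v y.
  by move=> /andP[ay yb]; have [yx|xy] := leP y x;
    [apply: apos; rewrite ay|apply: bpos; rewrite ltW].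
have Ia : I01 a by rewrite I01E; lra.
have Ib : I01 b by rewrite I01E; lra.
have W y : y \in `]a, b[ ->
    is_derive y 1 (wronskian u u1 v v1) (u y * v2 y - v y * u2 y).
  rewrite in_itv/= => /andP[ay yb].
  by apply: (wronskian_derive uC2 vC2); lra.
have cW : {within `[a, b], continuous (wronskian u u1 v v1)}.
  apply: continuous_subspaceW (wronskian_continuous uC2 vC2) => y.
  by rewrite /= I01E in_itv/=; lra.
have [c + Wc] := MVT ab W cW; rewrite in_itv/= => acb.
have c01 : 0 < c < 1 by lra.
have v1a : 0 <= v1 a.
  by apply: (deriv01_right_ge0 dv a0 ab b1 va) => y /vpos/ltW.
have v1b : v1 b <= 0.
  by apply: (deriv01_left_le0 dv a0 ab b1 vb) => y /vpos/ltW.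
have ua := positive_eigenfunction_ge0 Ia; have ub := positive_eigenfunction_ge0 Ib.
have Wle : wronskian u u1 v v1 b - wronskian u u1 v v1 a <= 0.
  by rewrite /wronskian va vb !mul0r !subr0; nra.
have W'E : u c * v2 c - v c * u2 c = (l - m) * (u c * v c).
  have := uE c01; have := vE c c01 => ev eu.
  have -> : v2 c = q c * v c - m * v c by lra.
  have -> : u2 c = q c * u c - l * u c by lra.
  ring.
have := upos c01; have := vpos c acb => vc uc.
have lm : 0 < l - m by lra.
have : 0 < (l - m) * (u c * v c) * (b - a).
  by rewrite !mulr_gt0//; lra.
by rewrite -W'E -Wc; lra.
Qed.

(** An eigenfunction with eigenvalue below [l] and its negative would both be nowhere positive,
    against nontriviality. *)
Lemma positive_eigenfunction_smallest : smallest_eigenvalue q l.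
Proof.
split.
  exists u, u1, u2; split => //; exists (1 / 2); first by rewrite I01E; lra.
  by rewrite gt_eqF// upos//; lra.
move=> m [v [v1 [v2 [vC2 v0 v1E [x Ix vx] vE]]]]; rewrite leNgt; apply/negP => ml.
have le := eigenvalue_lt_no_positive_value ml vC2 v0 v1E Ix vE.
have := eigenvalue_lt_no_positive_value ml (is_C2N vC2) _ _ Ix.
rewrite !fctE v0 v1E oppr0 => /(_ erefl erefl) ge.
suff : - v x <= 0 by move: vx; rewrite neq_lt; lra.
by apply: ge => y /vE; lra.
Qed.

End Comparison.

Lemma lambda_smallest q l : smallest_eigenvalue q l -> lambda q = l.
Proof.
move=> sl; rewrite /lambda; case: xgetP => [m _ /= sm|]; last by move=> /(_ l).
by apply/eqP; rewrite eq_le (sl.2 _ sm.1) (sm.2 _ sl.1).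
Qed.

End Sturm.

(** * Normalized antiderivatives and geometrically convergent sequences *)

Section Primitive.
Context {R : realType}.
Implicit Types (f g h F : R -> R) (x y M : R).

(** Selected by choice; for continuous [g] the set is nonempty and the default zero function is not
    taken. *)
Definition prim g : R -> R :=
  xget (fun=> 0) [set G | G 0 = 0 /\ forall x, is_derive x 1 G (g x)].

Lemma primP g : continuous g -> prim g 0 = 0 /\ forall x, is_derive x 1 (prim g) (g x).
Proof. by move=> cg; have := xgetPex (fun=> 0) (primitive cg). Qed.

Lemma prim0 g : continuous g -> prim g 0 = 0.
Proof. by move=> /primP[]. Qed.

Lemma prim_derive g x : continuous g -> is_derive x 1 (prim g) (g x).
Proof. by move=> /primP[_]. Qed.

Lemma norm_increment F f M x : (forall y, is_derive y 1 F (f y)) -> F 0 = 0 ->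
  (forall y, 0 <= y <= 1 -> `|f y| <= M) -> 0 <= x <= 1 -> `|F x| <= M.
Proof.
move=> dF F0 fM /andP[x0 x1].
have cF : {within `[0, x], continuous F}.
  by apply: continuous_subspaceT => y; exact: is_derive_continuous (dF y).
have fM' y : 0 < y < x -> - M <= f y <= M by move=> yx; rewrite -ler_norml; apply: fM; lra.
have := @le_increment R F f 0 x M x0 (fun y _ => dF y) cF (fun y yx => proj2 (andP (fM' y yx))).
have := @ge_increment R F f 0 x (- M) x0 (fun y _ => dF y) cF (fun y yx => proj1 (andP (fM' y yx))).
have : 0 <= M by apply: le_trans (fM 0 _); rewrite ?normr_ge0// lexx ler01.
by rewrite F0 !subr0 => M0 H1 H2; rewrite ler_norml; nra.
Qed.

Lemma prim_dist g h M x : continuous g -> continuous h ->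
  (forall y, 0 <= y <= 1 -> `|g y - h y| <= M) -> 0 <= x <= 1 ->
  `|prim g x - prim h x| <= M.
Proof.
move=> cg ch gh; apply: (@norm_increment (fun x => prim g x - prim h x)) gh.
  by move=> y; apply: is_derive1_sub; exact: prim_derive.
by rewrite !prim0// subrr.
Qed.

Lemma prim_norm g M x : continuous g ->
  (forall y, 0 <= y <= 1 -> `|g y| <= M) -> 0 <= x <= 1 -> `|prim g x| <= M.
Proof.
move=> cg; apply: norm_increment; last exact: prim0.
by move=> y; exact: prim_derive.
Qed.

(** Retraction of the line onto [0, 1], used to extend functions that are controlled on [0, 1] only;
    with absolute values its continuity is immediate. *)
Definition clip x : R := (`|x| - `|x - 1| + 1) / 2.

Lemma clip_I01 x : 0 <= clip x <= 1.
Proof. by rewrite /clip; case: (ler0P x) => x0; case: (ler0P (x - 1)) => x1; lra. Qed.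

Lemma clip_id x : 0 <= x <= 1 -> clip x = x.
Proof. by rewrite /clip; case: (ler0P x) => x0; case: (ler0P (x - 1)) => x1; lra. Qed.

Lemma clip_continuous : continuous clip.
Proof.
move=> x; apply: cvgM; last exact: cvg_cst.
apply: cvgD; last exact: cvg_cst.
apply: cvgB; apply: cvg_norm => //; apply: cvgB; [exact: cvg_id|exact: cvg_cst].
Qed.

(** With c = 1/(1 - r), telescoping makes a_n - c r^n nondecreasing and a_n + c r^n nonincreasing.
    Each lower bound lies below each upper one, so the supremum of the lower bounds is the limit. *)
Lemma geometric_limit (a : nat -> R) (r : R) : 0 < r < 1 ->
  (forall n, `|a n.+1 - a n| <= r ^+ n) ->
  exists l, forall n, `|a n - l| <= (1 - r)^-1 * r ^+ n.
Proof.
move=> /andP[r0 r1] ar; pose c := (1 - r)^-1.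
have cE : c = 1 + c * r by rewrite /c; field; lra.
have c0 : 0 < c by rewrite invr_gt0; lra.
have rn n : 0 < r ^+ n by rewrite exprn_gt0.
have up n k : a (n + k)%N <= a n + c * r ^+ n - c * r ^+ (n + k).
  elim: k => [|k IH]; first by rewrite addn0; lra.
  rewrite addnS; have := ar (n + k)%N; rewrite ler_norml => /andP[_].
  have : c * r ^+ (n + k) = r ^+ (n + k) + c * r ^+ (n + k).+1.
    by rewrite {1}cE exprS; ring.
  lra.
have down n k : a n - c * r ^+ n + c * r ^+ (n + k) <= a (n + k)%N.
  elim: k => [|k IH]; first by rewrite addn0; lra.
  rewrite addnS; have := ar (n + k)%N; rewrite ler_norml => /andP[+ _].
  have : c * r ^+ (n + k) = r ^+ (n + k) + c * r ^+ (n + k).+1.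
    by rewrite {1}cE exprS; ring.
  lra.
have cr n : 0 < c * r ^+ n by rewrite mulr_gt0.
have ord m n : a m - c * r ^+ m <= a n + c * r ^+ n.
  have [mn|/ltnW nm] := leqP m n.
    by have := down m (n - m)%N; rewrite subnKC//; have := cr n; lra.
  by have := up n (m - n)%N; rewrite subnKC//; have := cr m; lra.
pose Z := range (fun n => a n - c * r ^+ n).
exists (sup Z) => n; rewrite -/c.
have h1 : a n - c * r ^+ n <= sup Z.
  apply: ub_le_sup; last by exists n.
  by exists (a 0%N + c * r ^+ 0) => _ [m _ <-].
have h2 : sup Z <= a n + c * r ^+ n.
  by apply: ge_sup; [exists (a 0%N - c * r ^+ 0), 0%N | move=> _ [m _ <-]].
by rewrite ler_norml; lra.
Qed.

Lemma geometric_small (r C e : R) : 0 < r < 1 -> 0 < e ->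
  exists n, C * r ^+ n <= e.
Proof.
move=> /andP[r0 r1] e0; have [C0|C0] := leP C 0.
  by exists 0%N; rewrite expr0 mulr1; lra.
have /cvgrPdist_le/(_ (e / C)) : r ^+ n @[n --> \oo] --> 0.
  by apply: cvg_expr; rewrite ger0_norm// ltW.
rewrite divr_gt0// => /(_ erefl) [n _ /(_ n (leqnn n))].
rewrite sub0r normrN ger0_norm; last by rewrite exprn_ge0// ltW.
by rewrite ler_pdivlMr// mulrC => ?; exists n.
Qed.

Lemma geometric_eq0 (r C x : R) : 0 < r < 1 -> (forall n, `|x| <= C * r ^+ n) -> x = 0.
Proof.
move=> r01 H; apply/eqP; rewrite -normr_le0; apply/ler_addgt0Pl => e e0.
by rewrite addr0; have [n /(le_trans (H n))] := geometric_small C r01 e0.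
Qed.

End Primitive.

(** * Eigenfunctions of small perturbations *)

Section Perturbation.
Context {R : realType}.
Implicit Types (f g u v : R -> R) (x y m n : R).

Definition sin_pi x : R := sin (pi * x).
Definition cos_pi x : R := cos (pi * x).

Lemma pi_neq0 : (pi : R) != 0.
Proof. by rewrite gt_eqF ?pi_gt0. Qed.

Lemma is_derive_sin_pi x : is_derive x 1 sin_pi (pi * cos_pi x).
Proof.
rewrite mulrC; apply: is_derive1_comp.
by rewrite -{2}[pi]mulr1; apply: is_derive1_scale; exact: is_derive1_id.
Qed.

Lemma is_derive_cos_pi x : is_derive x 1 cos_pi (- (pi * sin_pi x)).
Proof.
rewrite -mulNr mulrC mulrN -mulNr; apply: is_derive1_comp.
by rewrite -{2}[pi]mulr1; apply: is_derive1_scale; exact: is_derive1_id.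
Qed.

Lemma sin_pi_continuous : continuous sin_pi.
Proof. by move=> x; exact: is_derive_continuous (is_derive_sin_pi x). Qed.

Lemma cos_pi_continuous : continuous cos_pi.
Proof. by move=> x; exact: is_derive_continuous (is_derive_cos_pi x). Qed.

Lemma norm_sin_pi x : `|sin_pi x| <= 1.
Proof. by rewrite ler_norml sin_geN1 sin_le1. Qed.

Lemma norm_cos_pi x : `|cos_pi x| <= 1.
Proof. by rewrite ler_norml cos_geN1 cos_le1. Qed.

Lemma sin_pi0 : sin_pi 0 = 0.
Proof. by rewrite /sin_pi mulr0 sin0. Qed.

Lemma sin_pi1 : sin_pi 1 = 0.
Proof. by rewrite /sin_pi mulr1 sinpi. Qed.

Lemma sin_pi2Dcos_pi2 x : sin_pi x ^+ 2 + cos_pi x ^+ 2 = 1.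
Proof. by rewrite addrC cos2Dsin2. Qed.

(** The doubled angle stays in [0, pi/2], where the cosine 2 cos^2 - 1 is nonnegative. The constant
    7/10 below is a rational under the square root of 1/2. *)
Lemma cos_pi_double_ge0 x : 0 <= x <= 1 / 4 -> 1 / 2 <= cos_pi x ^+ 2.
Proof.
move=> x14; have := pi_ge2 R => p2.
have px : 0 <= pi * x <= pi / 4.
  by move/andP: x14 => [x0 x1]; rewrite mulr_ge0 ?pi_ge0//= ler_wpM2l ?pi_ge0//; lra.
have : 0 <= cos (pi * x *+ 2) by apply: cos_ge0_pihalf; lra.
rewrite mulr2n cosD -!expr2 -/(cos_pi x) -/(sin_pi x).
by have := sin_pi2Dcos_pi2 x; lra.
Qed.

Lemma cos_pi_ge x : 0 <= x <= 1 / 4 -> 7 / 10 <= cos_pi x.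
Proof.
move=> x14; have := cos_pi_double_ge0 x14; have := pi_ge2 R => p2.
have px : 0 <= pi * x <= pi / 4.
  by move/andP: x14 => [x0 x1]; rewrite mulr_ge0 ?pi_ge0//= ler_wpM2l ?pi_ge0//; lra.
have : 0 <= cos_pi x by apply: cos_ge0_pihalf; lra.
by nra.
Qed.

Lemma cos_pi_sub1 x : cos_pi (1 - x) = - cos_pi x.
Proof. by rewrite /cos_pi mulrBr mulr1 cosB cospi sinpi; ring. Qed.

Lemma cos_pi_le x : 3 / 4 <= x <= 1 -> cos_pi x <= - (7 / 10).
Proof.
move=> x34; have : 7 / 10 <= cos_pi (1 - x) by apply: cos_pi_ge; lra.
by rewrite cos_pi_sub1; lra.
Qed.

Lemma sin_pi_ge x : 1 / 4 <= x <= 3 / 4 -> 7 / 10 <= sin_pi x.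
Proof.
move=> x14; have := pi_ge2 R => p2.
have px : pi / 4 <= pi * x <= pi * (3 / 4).
  by move/andP: x14 => [x0 x1]; rewrite !ler_wpM2l ?pi_ge0//; lra.
have s0 : 0 <= sin_pi x by apply: sin_ge0_pi; lra.
have : 0 <= cos (pi * x *+ 2 - pi) by apply: cos_ge0_pihalf; lra.
rewrite cosB cospi sinpi mulr2n cosD -!expr2 -/(cos_pi x) -/(sin_pi x).
by have := sin_pi2Dcos_pi2 x; nra.
Qed.

Section Iteration.
Variable beta : R -> R.
Hypothesis beta_continuous : continuous beta.
Hypothesis beta_small : forall x, `|beta x| <= 1 / 100.

(** For the eigenvalue 1/2 + pi^2 + m, the equation with potential 1/2 + beta reads u'' + pi^2 u =
    (beta - m) u. *)
Definition source u m x : R := (beta x - m) * u x.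

(* Variation of constants for w'' + pi^2 w = source u m, w(0) = 0, w'(0) = pi. *)
Definition next_fun u m x : R :=
  sin_pi x + pi^-1 * (sin_pi x * prim (cos_pi \* source u m) x
                     - cos_pi x * prim (sin_pi \* source u m) x).

Definition next_fun' u m x : R :=
  pi * cos_pi x + (cos_pi x * prim (cos_pi \* source u m) x
                  + sin_pi x * prim (sin_pi \* source u m) x).

(** A fixed [m] makes the integral of sin times the source vanish, which is the boundary condition
    w(1) = 0. The factor 2 is that of a Newton step: the integral of sin^2 is 1/2, so the dependence
    on [m] cancels to first order. *)
Definition next_val u m : R := m + 2 * prim (sin_pi \* source u m) 1.

(** The region kept invariant by the iteration, around the unperturbed eigenfunction and a zero
    shift of the eigenvalue. *)
Definition near_ground u m := [/\ continuous u,
  forall x, 0 <= x <= 1 -> `|u x - sin_pi x| <= 1 / 10 & `|m| <= 1 / 25].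

Lemma near_ground_norm u m x : near_ground u m -> 0 <= x <= 1 -> `|u x| <= 11 / 10.
Proof.
move=> [_ us _] x01; have := us x x01; have := norm_sin_pi x.
by rewrite !ler_norml; lra.
Qed.

Lemma source_continuous u m : continuous u -> continuous (source u m).
Proof.
move=> cu x; apply: cvgM; last exact: cu.
by apply: cvgB; [exact: beta_continuous|exact: cvg_cst].
Qed.

Lemma mulf_continuous f g : continuous f -> continuous g -> continuous (f \* g : R -> R).
Proof. by move=> cf cg x; apply: cvgM; [exact: cf|exact: cg]. Qed.

Lemma sin_pi_source_continuous u m : continuous u -> continuous (sin_pi \* source u m).
Proof.
by move=> cu; apply: mulf_continuous; [exact: sin_pi_continuous|exact: source_continuous].
Qed.

Lemma cos_pi_source_continuous u m : continuous u -> continuous (cos_pi \* source u m).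
Proof.
by move=> cu; apply: mulf_continuous; [exact: cos_pi_continuous|exact: source_continuous].
Qed.

Lemma next_fun_derive u m x : continuous u ->
  is_derive x 1 (next_fun u m) (next_fun' u m x).
Proof.
move=> cu.
have dc := prim_derive x (@cos_pi_source_continuous u m cu).
have ds := prim_derive x (@sin_pi_source_continuous u m cu).
have := is_derive1_add (is_derive_sin_pi x) (is_derive1_scale pi^-1
  (is_derive1_sub (is_derive1_mul (is_derive_sin_pi x) dc)
                  (is_derive1_mul (is_derive_cos_pi x) ds))).
congr is_derive; rewrite /next_fun' /=.
by move: (pi : R) pi_neq0 => p p0; field.
Qed.

Lemma next_fun'_derive u m x : continuous u ->
  is_derive x 1 (next_fun' u m) (- pi ^+ 2 * next_fun u m x + source u m x).
Proof.
move=> cu.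
have dc := prim_derive x (@cos_pi_source_continuous u m cu).
have ds := prim_derive x (@sin_pi_source_continuous u m cu).
have := is_derive1_add (is_derive1_scale pi (is_derive_cos_pi x))
  (is_derive1_add (is_derive1_mul (is_derive_cos_pi x) dc)
                  (is_derive1_mul (is_derive_sin_pi x) ds)).
congr is_derive; rewrite /next_fun /=.
(* The two source contributions carry cos^2 and sin^2; the factor 1 is expanded to match them. *)
rewrite -[X in _ + X = _]mulr1 -[source u m x in RHS]mulr1 -[in RHS](sin_pi2Dcos_pi2 x).
by move: (pi : R) pi_neq0 => p p0; field.
Qed.

Lemma next_fun_continuous u m : continuous u -> continuous (next_fun u m).
Proof. by move=> cu x; exact: is_derive_continuous (next_fun_derive m x cu). Qed.

Lemma pi_inv_le : 0 < (pi : R)^-1 <= 1 / 2.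
Proof.
have p2 := pi_ge2 R; rewrite invr_gt0 pi_gt0/= div1r lef_pV2// posrE ?pi_gt0//; lra.
Qed.

(** The antiderivative of sin^2 vanishing at 0; its value 1/2 at 1 lets the summand [m] of
    [next_val] be absorbed into an integral. *)
Definition sin_pi2_prim x : R := (x - pi^-1 * (sin_pi x * cos_pi x)) / 2.

Lemma sin_pi2_prim_derive x : is_derive x 1 sin_pi2_prim (sin_pi x * sin_pi x).
Proof.
have := is_derive1_mul (is_derive1_sub (is_derive1_id x) (is_derive1_scale pi^-1
  (is_derive1_mul (is_derive_sin_pi x) (is_derive_cos_pi x)))) (is_derive1_cst (2^-1) x).
congr is_derive; have := sin_pi2Dcos_pi2 x.
transitivity ((1 - (cos_pi x ^+ 2 - sin_pi x ^+ 2)) / 2); last lra.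
by move: (pi : R) pi_neq0 => p p0; field.
Qed.

Lemma normM_le (a b A B : R) : `|a| <= A -> `|b| <= B -> `|a * b| <= A * B.
Proof. by move=> aA bB; rewrite normrM ler_pM. Qed.

Lemma next_fun_dist0 u m x : near_ground u m -> 0 <= x <= 1 ->
  `|next_fun u m x - sin_pi x| <= 1 / 10.
Proof.
move=> G x01; have [cu us m25] := G.
(* Here 1/20 = 1/100 + 1/25 bounds beta - m and 11/10 bounds u. *)
have sM y : 0 <= y <= 1 -> `|source u m y| <= 1 / 20 * (11 / 10).
  move=> y01; apply: normM_le; last exact: near_ground_norm G y01.
  by have := beta_small y; move: m25; rewrite !ler_norml; lra.
have h1 : `|prim (cos_pi \* source u m) x| <= 1 * (1 / 20 * (11 / 10)).
  apply: prim_norm x01 => [|y y01]; first exact: cos_pi_source_continuous.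
  by apply: normM_le; [exact: norm_cos_pi|exact: sM].
have h2 : `|prim (sin_pi \* source u m) x| <= 1 * (1 / 20 * (11 / 10)).
  apply: prim_norm x01 => [|y y01]; first exact: sin_pi_source_continuous.
  by apply: normM_le; [exact: norm_sin_pi|exact: sM].
have := normM_le (norm_sin_pi x) h1; have := normM_le (norm_cos_pi x) h2.
have := pi_inv_le; rewrite /next_fun addrC addKr.
by rewrite !ler_norml; nra.
Qed.

Lemma next_near_ground u m : near_ground u m ->
  near_ground (next_fun u m \o clip) (next_val u m).
Proof.
move=> G; have [cu us m25] := G; split.
- move=> x; apply: continuous_comp; first exact: clip_continuous.
  exact: next_fun_continuous.
- by move=> x x01; rewrite /= clip_id//; exact: next_fun_dist0.
(* Twice [F 1] is [next_val u m], and in the derivative of [F] the value [m] only multiplies the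
   small difference u - sin. *)
pose F x := prim (sin_pi \* source u m) x + m * sin_pi2_prim x.
have dF x : is_derive x 1 F (sin_pi x * (beta x * u x - m * (u x - sin_pi x))).
  have := is_derive1_add (prim_derive x (sin_pi_source_continuous (m := m) cu))
    (is_derive1_scale m (sin_pi2_prim_derive x)).
  by congr is_derive; rewrite /= /source; ring.
have F0 : F 0 = 0.
  rewrite /F prim0; last exact: sin_pi_source_continuous.
  by rewrite /sin_pi2_prim sin_pi0; ring.
have : `|F 1| <= 1 * (1 / 100 * (11 / 10) + 1 / 25 * (1 / 10)).
  apply: (norm_increment dF F0) => [y y01|]; last by rewrite ler01 lexx.
  apply: normM_le; first exact: norm_sin_pi.
  apply: le_trans (ler_normB _ _) _; apply: lerD.
    by apply: normM_le (near_ground_norm G y01).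
  by apply: normM_le (us y y01).
rewrite /F /sin_pi2_prim sin_pi1 /next_val !ler_norml; lra.
Qed.

(** Contraction for the maximum of the sup distance and 4 times the distance of values. The weight 4
    tames the term (m - n) v in the source; the factor 3/5 comes from the value component, 8 (1/20 +
    1/40). *)
Lemma next_contraction u m v n (D : R) : near_ground u m -> near_ground v n ->
  (forall x, 0 <= x <= 1 -> `|u x - v x| <= D) -> 4 * `|m - n| <= D ->
  (forall x, 0 <= x <= 1 -> `|next_fun u m x - next_fun v n x| <= 3 / 5 * D) /\
  4 * `|next_val u m - next_val v n| <= 3 / 5 * D.
Proof.
move=> Gu Gv uv mn; have [cu us m25] := Gu; have [cv vs n25] := Gv.
have mn4 : `|m - n| <= D / 4 by rewrite ler_pdivlMr// mulrC.
have D0 : 0 <= D by apply: le_trans (uv 0 _); rewrite // lexx ler01.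
have bm y : `|beta y - m| <= 1 / 20.
  by have := beta_small y; move: m25; rewrite !ler_norml; lra.
have sD y : 0 <= y <= 1 ->
    `|source u m y - source v n y| <= 1 / 20 * D + D / 4 * (11 / 10).
  move=> y01; have -> : source u m y - source v n y =
      (beta y - m) * (u y - v y) - (m - n) * v y by rewrite /source; ring.
  apply: le_trans (ler_normB _ _) _; apply: lerD.
    exact: normM_le (bm y) (uv y y01).
  exact: normM_le mn4 (near_ground_norm Gv y01).
split=> [x x01|].
  have h1 : `|prim (cos_pi \* source u m) x - prim (cos_pi \* source v n) x| <=
      1 * (1 / 20 * D + D / 4 * (11 / 10)).
    apply: prim_dist x01 => [||y y01]; try exact: cos_pi_source_continuous.
    by rewrite /= -mulrBr; apply: normM_le (norm_cos_pi y) (sD y y01).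
  have h2 : `|prim (sin_pi \* source u m) x - prim (sin_pi \* source v n) x| <=
      1 * (1 / 20 * D + D / 4 * (11 / 10)).
    apply: prim_dist x01 => [||y y01]; try exact: sin_pi_source_continuous.
    by rewrite /= -mulrBr; apply: normM_le (norm_sin_pi y) (sD y y01).
  have h3 := normM_le (norm_sin_pi x) h1; have h4 := normM_le (norm_cos_pi x) h2.
  have -> : next_fun u m x - next_fun v n x = pi^-1 *
     (sin_pi x * (prim (cos_pi \* source u m) x - prim (cos_pi \* source v n) x) -
      cos_pi x * (prim (sin_pi \* source u m) x - prim (sin_pi \* source v n) x)).
    by rewrite /next_fun; ring.
  have pi2 : `|(pi : R)^-1| <= 1 / 2.
    by have /andP[p0 p2] := pi_inv_le; rewrite gtr0_norm.
  have := normM_le pi2 (le_trans (ler_normB _ _) (lerD h3 h4)).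
  by move=> /le_trans; apply; lra.
pose F x := prim (sin_pi \* source u m) x - prim (sin_pi \* source v n) x
  + (m - n) * sin_pi2_prim x.
have dF x : is_derive x 1 F (sin_pi x * ((beta x - m) * (u x - v x)
    - (m - n) * (v x - sin_pi x))).
  have := is_derive1_add (is_derive1_sub
    (prim_derive x (sin_pi_source_continuous (m := m) cu))
    (prim_derive x (sin_pi_source_continuous (m := n) cv)))
    (is_derive1_scale (m - n) (sin_pi2_prim_derive x)).
  by congr is_derive; rewrite /= /source; ring.
have F0 : F 0 = 0.
  rewrite /F !prim0; try exact: sin_pi_source_continuous.
  by rewrite /sin_pi2_prim sin_pi0; ring.
have : `|F 1| <= 1 * (1 / 20 * D + D / 4 * (1 / 10)).
  apply: (norm_increment dF F0) => [y y01|]; last by rewrite ler01 lexx.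
  apply: normM_le; first exact: norm_sin_pi.
  apply: le_trans (ler_normB _ _) _; apply: lerD.
    exact: normM_le (bm y) (uv y y01).
  exact: normM_le mn4 (vs y y01).
have -> : next_val u m - next_val v n = 2 * F 1.
  rewrite /F /next_val /sin_pi2_prim sin_pi1.
  by move: (pi : R) pi_neq0 => p p0; field.
by rewrite normrM (@ger0_norm _ 2)//; lra.
Qed.

Lemma perturbed_fixpoint : exists u m, [/\ near_ground u m,
  forall x, 0 <= x <= 1 -> u x = next_fun u m x & m = next_val u m].
Proof.
pose step (p : (R -> R) * R) := (next_fun p.1 p.2 \o clip, next_val p.1 p.2).
pose it k := iter k step (sin_pi, 0).
pose r : R := 3 / 5; have r01 : 0 < r < 1 by rewrite /r; lra.
have r0 k : 0 < r ^+ k by rewrite exprn_gt0//; lra.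
have Git k : near_ground (it k).1 (it k).2.
  elim: k => [|k IH]; last exact: next_near_ground.
  split => [|x _|]; [exact: sin_pi_continuous|rewrite subrr|]; rewrite normr0; lra.
have dit k : (forall x, 0 <= x <= 1 -> `|(it k.+1).1 x - (it k).1 x| <= r ^+ k) /\
    4 * `|(it k.+1).2 - (it k).2| <= r ^+ k.
  elim: k => [|k [IH1 IH2]].
    have [_ us ms] := Git 1%N; rewrite expr0; split=> [x x01|].
      by apply: le_trans (us x x01) _; lra.
    by rewrite subr0; lra.
  have [H1 H2] := next_contraction (Git k.+1) (Git k) IH1 IH2.
  rewrite exprS; split => // x x01; rewrite /= !clip_id//; exact: H1.
(* Clipping defines the limit on the whole line with uniform convergence there, hence its
   continuity. *)
have lim_u x : exists l, forall k, `|(it k).1 (clip x) - l| <= (1 - r)^-1 * r ^+ k.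
  by apply: (geometric_limit r01) => k; apply: (dit k).1; exact: clip_I01.
have [m mlim] : exists m, forall k, `|4 * (it k).2 - m| <= (1 - r)^-1 * r ^+ k.
  apply: (geometric_limit r01) => k; rewrite -mulrBr normrM (@ger0_norm _ 4)//.
  exact: (dit k).2.
have [u ulim] := choice lim_u.
have ulim' k x : 0 <= x <= 1 -> `|(it k).1 x - u x| <= (1 - r)^-1 * r ^+ k.
  by move=> x01; have := ulim x k; rewrite clip_id.
have mlim' k : 4 * `|(it k).2 - m / 4| <= (1 - r)^-1 * r ^+ k.
  rewrite -[X in X * _](@ger0_norm _ 4)// -normrM mulrBr.
  have -> : 4 * (m / 4) = m by field.
  exact: mlim.
have cu : continuous u.
  move=> x; apply/cvgrPdist_le => e e0.
  have e3 : 0 < e / 3 by lra.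
  have [k ke] := geometric_small (1 - r)^-1 r01 e3.
  have cuk : {for x, continuous ((it k).1 \o clip)}.
    have [cuk _ _] := Git k.
    by apply: continuous_comp; [exact: clip_continuous|exact: cuk].
  have /cvgrPdist_le/(_ _ e3) := cuk; apply: filterS => y /= xy.
  have := le_trans (ulim x k) ke; have := le_trans (ulim y k) ke.
  by move: xy; rewrite !ler_norml; lra.
have G : near_ground u (m / 4).
  split => // [x x01|]; apply/ler_addgt0Pl => e e0.
    have [k ke] := geometric_small (1 - r)^-1 r01 e0.
    have [_ us _] := Git k; have := us x x01; have := le_trans (ulim' k x x01) ke.
    rewrite !ler_norml; lra.
  have [k ke] := geometric_small (1 - r)^-1 r01 e0.
  have [_ _ ms] := Git k; move: ms; have := le_trans (mlim' k) ke.
  have e4 : e / 4 <= e by lra.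
  move=> h1 h2; have : `|(it k).2 - m / 4| <= e / 4 by lra.
  by move: h2; rewrite !ler_norml; lra.
(* Contracting the distance from the k-th iterate to the limit shows that the iterates also converge
   to the image of the limit, which is therefore fixed. *)
have main k : (forall x, 0 <= x <= 1 -> `|(it k.+1).1 x - next_fun u (m / 4) x| <=
      r * ((1 - r)^-1 * r ^+ k)) /\
    4 * `|(it k.+1).2 - next_val u (m / 4)| <= r * ((1 - r)^-1 * r ^+ k).
  have [H1 H2] := next_contraction (Git k) G (ulim' k) (mlim' k).
  by split => // x x01; rewrite /= clip_id//; exact: H1.
exists u, (m / 4); split => // [x x01|].
  apply/eqP; rewrite -subr_eq0; apply/eqP.
  apply: (@geometric_eq0 _ r (2 * r * (1 - r)^-1)) => // k.
  have := (main k).1 x x01; have := ulim' k.+1 x x01; rewrite exprS.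
  by rewrite !ler_norml; lra.
apply/eqP; rewrite -subr_eq0; apply/eqP.
apply: (@geometric_eq0 _ r (2 * r * (1 - r)^-1)) => // k.
have := (main k).2; have := mlim' k.+1; rewrite exprS => h1 h2.
have : `|m / 4 - next_val u (m / 4)| <=
    `|(it k.+1).2 - m / 4| + `|(it k.+1).2 - next_val u (m / 4)|.
  by rewrite [X in _ <= X + _]distrC; exact: ler_distD.
have := normr_ge0 ((it k.+1).2 - m / 4).
by have := normr_ge0 ((it k.+1).2 - next_val u (m / 4)); lra.
Qed.

Lemma perturbed_eigenfunction : exists m u u1 u2,
  [/\ is_C2 u u1 u2, u 0 = 0 & u 1 = 0] /\
  [/\ forall x, 0 <= x <= 1 -> `|u x - sin_pi x| <= 1 / 10,
      forall x, 0 < x < 1 -> 0 < u x &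
      forall x, 0 < x < 1 -> - u2 x + (1 / 2 + beta x) * u x = m * u x].
Proof.
have [w [m [G wE mE]]] := perturbed_fixpoint; have [cw ws m25] := G.
(* [w] equals its image on [0, 1] only, whereas [U] is twice differentiable on the whole line. *)
pose U := next_fun w m.
have dU x : is_derive x 1 U (next_fun' w m x) by exact: next_fun_derive.
have cU : continuous U by exact: next_fun_continuous.
have cU' : continuous (next_fun' w m).
  by move=> x; exact: is_derive_continuous (next_fun'_derive m x cw).
have Pc x : 0 <= x <= 1 -> `|prim (cos_pi \* source w m) x| <= 1 / 10.
  move=> x01; apply: prim_norm x01 => [|y y01]; first exact: cos_pi_source_continuous.
  apply: (@le_trans _ _ (1 * (1 / 20 * (11 / 10)))); last lra.
  apply: normM_le; first exact: norm_cos_pi.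
  apply: normM_le; last exact: near_ground_norm G y01.
  by have := beta_small y; move: m25; rewrite !ler_norml; lra.
have Ps x : 0 <= x <= 1 -> `|prim (sin_pi \* source w m) x| <= 1 / 10.
  move=> x01; apply: prim_norm x01 => [|y y01]; first exact: sin_pi_source_continuous.
  apply: (@le_trans _ _ (1 * (1 / 20 * (11 / 10)))); last lra.
  apply: normM_le; first exact: norm_sin_pi.
  apply: normM_le; last exact: near_ground_norm G y01.
  by have := beta_small y; move: m25; rewrite !ler_norml; lra.
have U'dist x : 0 <= x <= 1 -> `|next_fun' w m x - pi * cos_pi x| <= 1 / 5.
  move=> x01; rewrite /next_fun' addrC addKr.
  apply: le_trans (ler_normD _ _) _.
  have := lerD (normM_le (norm_cos_pi x) (Pc x x01)) (normM_le (norm_sin_pi x) (Ps x x01)).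
  by move=> /le_trans; apply; lra.
have U0 : U 0 = 0.
  rewrite /U /next_fun !prim0; first by rewrite sin_pi0; ring.
    exact: sin_pi_source_continuous.
  exact: cos_pi_source_continuous.
(* At 1 only the sine primitive survives, and the fixed point equation for [m] makes it vanish. *)
have U1 : U 1 = 0.
  have : prim (sin_pi \* source w m) 1 = 0.
    by move: mE; rewrite /next_val; lra.
  by rewrite /U /next_fun => ->; rewrite sin_pi1; ring.
have p2 := pi_ge2 R.
have cUab a b : {within `[a, b], continuous U} by apply: continuous_subspaceT.
exists (1 / 2 + pi ^+ 2 + m), U, (next_fun' w m),
  (fun x => - pi ^+ 2 * U x + source w m x); split; split => //.
- split; first exact: is_derive_deriv01.
    by apply: is_derive_deriv01 => x _; exact: next_fun'_derive.
  apply: continuous_subspaceT => x; apply: cvgD; last exact: source_continuous.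
  by apply: cvgM; [exact: cvg_cst|exact: cU].
- by move=> x x01; exact: next_fun_dist0.
(* Positivity: on the outer quarters the slope has size at least 2 * 7/10 - 1/5 and [U] vanishes at
   the end; on the middle half [U] is at least 7/10 - 1/10. *)
- move=> x /andP[x0 x1]; have [x14|x14] := leP x (1 / 4).
    have : 1 * (x - 0) <= U x - U 0.
      apply: (@ge_increment R U (next_fun' w m)) => //; first exact: ltW.
      move=> y y0x; have /U'dist : 0 <= y <= 1 by lra.
      have : 7 / 10 <= cos_pi y by apply: cos_pi_ge; lra.
      by rewrite ler_norml; nra.
    by rewrite U0; lra.
  have [x34|x34] := leP x (3 / 4).
    have : `|U x - sin_pi x| <= 1 / 10 by apply: next_fun_dist0 => //; lra.
    have : 7 / 10 <= sin_pi x by apply: sin_pi_ge; lra.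
    by rewrite ler_norml; lra.
  have : U 1 - U x <= - 1 * (1 - x).
    apply: (@le_increment R U (next_fun' w m)) => //; first exact: ltW.
    move=> y yx1; have /U'dist : 0 <= y <= 1 by lra.
    have : cos_pi y <= - (7 / 10) by apply: cos_pi_le; lra.
    by rewrite ler_norml; nra.
  by rewrite U1; lra.
- move=> x /andP[x0 x1]; rewrite /source wE; last by rewrite !ltW.
  by rewrite -/U; ring.
Qed.

End Iteration.
End Perturbation.

(** * Eigenvalue gaps *)

Section Gap.
Context {R : realType}.
Implicit Types (f g u v b : R -> R) (x y s t : R).

(* The Wronskian of the positive eigenfunctions u of 1/2 + b and v of 1/2 + c
   vanishes at both ends and has derivative (c - b - Delta) u v, where Delta is
   the difference of the eigenvalues. *)
Lemma lambda_gap b c (s t r : R) : continuous b -> continuous c ->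
  (forall x, `|b x| <= 1 / 100) -> (forall x, `|c x| <= 1 / 100) ->
  (forall x, b x <= c x) -> 1 / 4 <= s -> s < t -> t <= 3 / 4 -> 0 < r ->
  (forall x, s < x < t -> r <= c x - b x) ->
  lambda (fun x => 1 / 2 + b x) + r * (t - s) / 8 <= lambda (fun x => 1 / 2 + c x).
Proof.
move=> cb cc b1 c1 bc s14 st t34 r0 rbc.
have [m [u [u1 [u2 [[uC2 u0 u1E] [us upos uE]]]]]] := perturbed_eigenfunction cb b1.
have [n [v [v1 [v2 [[vC2 v0 v1E] [vs vpos vE]]]]]] := perturbed_eigenfunction cc c1.
rewrite (lambda_smallest (positive_eigenfunction_smallest uC2 u0 u1E upos uE)).
rewrite (lambda_smallest (positive_eigenfunction_smallest vC2 v0 v1E vpos vE)).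
pose W := wronskian u u1 v v1.
have dW x : 0 < x < 1 -> is_derive x 1 W ((c x - b x - (n - m)) * (u x * v x)).
  move=> x01; have := wronskian_derive uC2 vC2 x01; congr is_derive.
  have -> : v2 x = (1 / 2 + c x) * v x - n * v x by have := vE x x01; lra.
  have -> : u2 x = (1 / 2 + b x) * u x - m * u x by have := uE x x01; lra.
  ring.
have cW a1 a2 : 0 <= a1 -> a2 <= 1 -> {within `[a1, a2], continuous W}.
  move=> a10 a21; apply: continuous_subspaceW (wronskian_continuous uC2 vC2) => y.
  by rewrite /= I01E in_itv/=; lra.
(* A nonnegative substitute for n - m, whose sign is still unknown; the final bound makes [K]
   positive, so that K = n - m. *)
pose K := Num.max (n - m) 0.
have K0 : 0 <= K by rewrite le_max lexx orbT.
have nmK : n - m <= K by rewrite le_max lexx.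
have uv2 x : 0 < x < 1 -> 0 < u x * v x <= 2.
  move=> x01; rewrite mulr_gt0 ?upos ?vpos//=.
  have x01' : 0 <= x <= 1 by lra.
  have := us x x01'; have := vs x x01'; have := norm_sin_pi x.
  have := upos x x01; have := vpos x x01.
  rewrite !ler_norml => v0' u0' sx vx ux.
  have ux2 : u x <= 14 / 10 by lra.
  have vx2 : v x <= 14 / 10 by lra.
  by apply: le_trans (ler_pM _ _ ux2 vx2) _; lra.
have W'ge x : 0 < x < 1 -> - 2 * K <= (c x - b x - (n - m)) * (u x * v x).
  by move=> x01; have := uv2 x x01; have := bc x; nra.
have W'ge' x : s < x < t -> r / 4 - 2 * K <= (c x - b x - (n - m)) * (u x * v x).
  move=> xst; have x01 : 0 < x < 1 by lra.
  have x01' : 0 <= x <= 1 by lra.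
  have /andP[uv0 uvle] := uv2 x x01; have rx := rbc x xst.
  have sx : 7 / 10 <= sin_pi x by apply: sin_pi_ge; lra.
  have ux : 1 / 2 <= u x by have := us x x01'; rewrite ler_norml; lra.
  have vx : 1 / 2 <= v x by have := vs x x01'; rewrite ler_norml; lra.
  have uv4 : 1 / 4 <= u x * v x by nra.
  have h1 : r / 4 <= (c x - b x) * (u x * v x).
    by have : r * (1 / 4) <= (c x - b x) * (u x * v x); [apply: ler_pM => //; lra|lra].
  have h2 : (n - m) * (u x * v x) <= 2 * K.
    apply: (@le_trans _ _ (K * (u x * v x))); first by rewrite ler_wpM2r// ltW.
    by rewrite mulrC ler_wpM2r.
  by rewrite mulrBl; lra.
have i1 : - 2 * K * (s - 0) <= W s - W 0.
  apply: (@ge_increment R W (fun x => (c x - b x - (n - m)) * (u x * v x))); first lra.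
  - by move=> x xs; apply: dW; lra.
  - by apply: cW; lra.
  - by move=> x xs; apply: W'ge; lra.
have i2 : (r / 4 - 2 * K) * (t - s) <= W t - W s.
  apply: (@ge_increment R W (fun x => (c x - b x - (n - m)) * (u x * v x))); first lra.
  - by move=> x xs; apply: dW; lra.
  - by apply: cW; lra.
  - exact: W'ge'.
have i3 : - 2 * K * (1 - t) <= W 1 - W t.
  apply: (@ge_increment R W (fun x => (c x - b x - (n - m)) * (u x * v x))); first lra.
  - by move=> x xs; apply: dW; lra.
  - by apply: cW; lra.
  - by move=> x xs; apply: W'ge; lra.
have W0 : W 0 = 0 by rewrite /W /wronskian u0 v0; ring.
have W1 : W 1 = 0 by rewrite /W /wronskian u1E v1E; ring.
have rts : 0 < r * (t - s) by rewrite mulr_gt0// subr_gt0.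
(* The three increments add up to W(1) - W(0) = 0, that is r (t - s) / 4 <= 2 K. *)
have KE : r * (t - s) / 8 <= K by lra.
have : K = n - m by move: KE; rewrite /K; case: (leP (n - m) 0) => // _; lra.
by move: KE; lra.
Qed.

End Gap.

(** * A compactly supported bump of class C^2 *)

Section Bump.
Context {R : realType}.
Implicit Types (f : R -> R) (x y z a h : R).

Definition pos_part z : R := Num.max 0 z.

Lemma pos_part_continuous : continuous pos_part.
Proof.
have -> : pos_part = fun z => (z + `|z|) / 2.
  by apply/funext => z; rewrite /pos_part; case: (leP 0 z) => z0;
    [rewrite ger0_norm|rewrite ltr0_norm]; lra.
move=> z; apply: cvgM; last exact: cvg_cst.
by apply: cvgD; [exact: cvg_id|exact: cvg_norm].
Qed.

(** Away from 0 the function is locally a power or zero; at 0 its Caratheodory slope is the power of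
    one lower exponent, which vanishes there. *)
Lemma is_derive_pos_partX n z :
  is_derive z 1 (fun t => pos_part t ^+ n.+2) (n.+2%:R * pos_part z ^+ n.+1).
Proof.
case: (ltgtP 0 z) => [z0|z0|<-].
- rewrite {2}/pos_part max_r ?ltW//.
  apply: (@near_eq_is_derive _ _ _ (fun t : R => t ^+ n.+2 : R)).
    near=> t; rewrite /pos_part max_r// ltW//; near: t; exact: lt_nbhsr.
  have dX := is_deriveX n.+2 (is_derive1_id z).
  have -> : (fun t : R => t ^+ n.+2) = (fun t : R => t) ^+ n.+2.
    by apply/funext => t; rewrite exprfctE.
  by move: dX; rewrite [_ *: _]mulr1.
- rewrite {2}/pos_part max_l ?ltW// expr0n mulr0.
  apply: (@near_eq_is_derive _ _ _ (fun=> 0 : R)).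
  near=> t; rewrite /pos_part max_l ?expr0n// ltW//; near: t; exact: lt_nbhsl.
- apply/is_derive1_caratheodory; exists (fun t => pos_part t ^+ n.+1).
  have p0 : pos_part 0 = 0 by rewrite /pos_part maxxx.
  split; last by rewrite p0 !expr0n mulr0.
    move=> t; rewrite p0 expr0n !subr0 /pos_part.
    by case: (leP 0 t) => t0; [rewrite -exprSr|rewrite !expr0n mul0r].
  apply: (@continuous_comp _ _ _ pos_part (fun t => t ^+ n.+1)).
    exact: pos_part_continuous.
  exact: exprn_continuous.
Unshelve. all: by end_near. Qed.

(** The quadratic has simple zeros at 0 and 1; its cube makes the second derivative vanish
    continuously there. *)
Definition c2bump y : R := pos_part (y * (1 - y)) ^+ 3.
Definition c2bump' y : R := 3 * pos_part (y * (1 - y)) ^+ 2 * (1 - 2 * y).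
Definition c2bump'' y : R :=
  6 * pos_part (y * (1 - y)) * (1 - 2 * y) ^+ 2 - 6 * pos_part (y * (1 - y)) ^+ 2.

Lemma is_derive_quadratic y : is_derive y 1 (fun t => t * (1 - t)) (1 - 2 * y).
Proof.
have := is_derive1_mul (is_derive1_id y)
  (is_derive1_sub (is_derive1_cst 1 y) (is_derive1_id y)).
by congr is_derive; ring.
Qed.

Lemma is_derive_c2bump y : is_derive y 1 c2bump (c2bump' y).
Proof. exact: (is_derive1_comp (is_derive_pos_partX 1 _) (is_derive_quadratic y)). Qed.

Lemma is_derive_c2bump' y : is_derive y 1 c2bump' (c2bump'' y).
Proof.
have d2 := is_derive1_comp (is_derive_pos_partX 0 _) (is_derive_quadratic y).
have dl := is_derive1_sub (is_derive1_cst 1 y) (is_derive1_scale 2 (is_derive1_id y)).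
have := is_derive1_mul (is_derive1_scale 3 d2) dl.
by congr is_derive; rewrite /c2bump'' /=; ring.
Qed.

Lemma c2bump''_continuous : continuous c2bump''.
Proof.
have cq : continuous (fun t : R => t * (1 - t)).
  by move=> x; exact: is_derive_continuous (is_derive_quadratic x).
have cp : continuous (fun t : R => pos_part (t * (1 - t))).
  move=> x; apply: (@continuous_comp _ _ _ (fun t : R => t * (1 - t)) pos_part).
    exact: cq.
  exact: pos_part_continuous.
have cl : continuous (fun t : R => 1 - 2 * t).
  move=> x; apply: is_derive_continuous (is_derive1_sub (is_derive1_cst 1 x)
    (is_derive1_scale 2 (is_derive1_id x))).
move=> x; apply: cvgB; apply: cvgM.
- by apply: cvgM; [exact: cvg_cst|exact: cp].
- by apply: (@continuous_comp _ _ _ (fun t : R => 1 - 2 * t) (fun t => t ^+ 2));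
    [exact: cl|exact: exprn_continuous].
- exact: cvg_cst.
- by apply: (@continuous_comp _ _ _ (fun t : R => pos_part (t * (1 - t))) (fun t => t ^+ 2));
    [exact: cp|exact: exprn_continuous].
Qed.

Lemma pos_part_quadratic y : 0 < pos_part (y * (1 - y)) ->
  0 < y < 1 /\ pos_part (y * (1 - y)) = y * (1 - y).
Proof.
by rewrite /pos_part; case: (leP 0 (y * (1 - y))); rewrite ?ltxx// => _ H; split => //;
  have := sqr_ge0 y; have := sqr_ge0 (y - 1); lra.
Qed.

Lemma c2bump_outside y : ~ 0 < y < 1 -> [/\ c2bump y = 0, c2bump' y = 0 & c2bump'' y = 0].
Proof.
move=> y01; have p0 : pos_part (y * (1 - y)) = 0.
  apply/eqP; apply: contra_notT y01 => pn0.
  have : 0 < pos_part (y * (1 - y)) by rewrite lt_neqAle eq_sym pn0 /pos_part le_max lexx.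
  by case/pos_part_quadratic.
by rewrite /c2bump /c2bump' /c2bump'' p0; split; ring.
Qed.

Lemma pos_part_inside y : 0 < y < 1 -> pos_part (y * (1 - y)) = y * (1 - y).
Proof. by move=> y01; rewrite /pos_part max_r//; nra. Qed.

Lemma c2bump_ge0 y : 0 <= c2bump y.
Proof. by rewrite exprn_ge0// /pos_part le_max lexx. Qed.

(** Everything is expressed in p = y (1 - y), which lies in [0, 1/4], through (1 - 2y)^2 = 1 -
    4p. *)
Lemma c2bump_bounds y : [/\ `|c2bump y| <= 1 / 64, `|c2bump' y| <= 1 & `|c2bump'' y| <= 2].
Proof.
have [y01|y01] := pselect (0 < y < 1); last first.
  by have [-> -> ->] := c2bump_outside y01; rewrite normr0; split; lra.
rewrite /c2bump /c2bump' /c2bump'' pos_part_inside//.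
have [p0 p1] : 0 <= y * (1 - y) /\ y * (1 - y) <= 1 / 4.
  by have := sqr_ge0 (y - 1 / 2); split; [rewrite mulr_ge0//; lra|lra].
have e2 : (1 - 2 * y) ^+ 2 = 1 - 4 * (y * (1 - y)) by ring.
rewrite e2; move: p0 p1; set p := y * (1 - y) => p0 p1.
split.
- rewrite ger0_norm ?exprn_ge0//.
  apply: le_trans (_ : (1 / 4) ^+ 3 <= _); last by rewrite expr_div_n expr1n; lra.
  by rewrite lerXn2r// nnegrE; lra.
- rewrite ler_norml; have : p ^+ 2 <= 1 / 16 by nra.
  by have := sqr_ge0 p; nra.
- by rewrite ler_norml; nra.
Qed.

Lemma c2bump_ge y : 1 / 4 <= y <= 3 / 4 -> 1 / 160 <= c2bump y.
Proof.
move=> y14; rewrite /c2bump pos_part_inside; last lra.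
have p : 3 / 16 <= y * (1 - y) by nra.
apply: le_trans (_ : _ <= (3 / 16) ^+ 3) _; first by rewrite expr_div_n; lra.
by rewrite lerXn2r// nnegrE; lra.
Qed.

End Bump.

(** * The fooling family *)

Section Family.
Context {R : realType}.
Variable N : nat.
Hypothesis N0 : (0 < N)%N.
Implicit Types (x y : R) (i j k : 'I_N) (J : {set 'I_N}).

Definition width : R := (2 * N%:R)^-1.
Definition left_end j : R := 1 / 4 + j%:R * width.
Definition cell_coord j x : R := (x - left_end j) / width.

(** The amplitude compensates the factor [width]^-2 of two derivatives; the half meets the bound 2
    on [c2bump''], so that second derivatives stay within 1. *)
Definition cell_bump j x : R := width ^+ 2 / 2 * c2bump (cell_coord j x).
Definition cell_bump' j x : R := width / 2 * c2bump' (cell_coord j x).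
Definition cell_bump'' j x : R := 1 / 2 * c2bump'' (cell_coord j x).

Definition bumps J x : R := \sum_(j in J) cell_bump j x.

Definition potential J x : R := 1 / 2 + bumps J x.

Lemma width_gt0 : 0 < width.
Proof. by rewrite invr_gt0 mulr_gt0// ltr0n. Qed.

Lemma width_le : width <= 1 / 2.
Proof.
rewrite div1r lef_pV2 ?posrE ?mulr_gt0 ?ltr0n//.
by rewrite -[leLHS]mulr1 ler_wpM2l// ler1n.
Qed.

Lemma width_card : N%:R * width = 1 / 2.
Proof.
have : (N%:R : R) != 0 by rewrite pnatr_eq0 -lt0n.
by rewrite /width => N1; field.
Qed.

Lemma is_derive_cell_coord j x : is_derive x 1 (cell_coord j) width^-1.
Proof.
have := is_derive1_mul (is_derive1_sub (is_derive1_id x) (is_derive1_cst (left_end j) x))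
  (is_derive1_cst width^-1 x).
by congr is_derive; ring.
Qed.

Lemma is_derive_cell_bump j x : is_derive x 1 (cell_bump j) (cell_bump' j x).
Proof.
have := is_derive1_scale (width ^+ 2 / 2)
  (is_derive1_comp (is_derive_c2bump _) (is_derive_cell_coord j x)).
congr is_derive; rewrite /cell_bump'.
by move: (width) (c2bump' _) (gt_eqF width_gt0) => w b /negbT w0; field.
Qed.

Lemma is_derive_cell_bump' j x : is_derive x 1 (cell_bump' j) (cell_bump'' j x).
Proof.
have := is_derive1_scale (width / 2)
  (is_derive1_comp (is_derive_c2bump' _) (is_derive_cell_coord j x)).
congr is_derive; rewrite /cell_bump''.
by move: (width) (c2bump'' _) (gt_eqF width_gt0) => w b /negbT w0; field.
Qed.

Lemma cell_bump''_continuous j : continuous (cell_bump'' j).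
Proof.
move=> x; apply: cvgM; first exact: cvg_cst.
apply: (@continuous_comp _ _ _ (cell_coord j) c2bump'').
  exact: is_derive_continuous (is_derive_cell_coord j x).
exact: c2bump''_continuous.
Qed.

Lemma cell_bump_outside j x : ~ left_end j < x < left_end j + width ->
  [/\ cell_bump j x = 0, cell_bump' j x = 0 & cell_bump'' j x = 0].
Proof.
move=> out; have : ~ 0 < cell_coord j x < 1.
  move: out width_gt0; rewrite /cell_coord; move: (width) (left_end j) => w l out w0 y01.
  by apply: out; move: y01; rewrite ltr_pdivlMr// ltr_pdivrMr//; lra.
move=> /c2bump_outside[b0 b1 b2].
by rewrite /cell_bump /cell_bump' /cell_bump'' b0 b1 b2 !mulr0.
Qed.

Lemma cells_disjoint j k x : left_end j < x < left_end j + width ->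
  left_end k < x < left_end k + width -> j = k.
Proof.
have lt i1 i2 : (i1 < i2)%N -> left_end i1 < x < left_end i1 + width ->
    left_end i2 < x < left_end i2 + width -> False.
  move=> i12; have : (i1%:R + 1) * width <= i2%:R * width.
    by rewrite ler_wpM2r ?(ltW width_gt0)// natr1 ler_nat.
  by rewrite /left_end; lra.
move=> xj xk; apply/val_inj; case: (ltngtP j k) => // jk.
  by case: (lt _ _ jk xj xk).
by case: (lt _ _ jk xk xj).
Qed.

Lemma cell_bump_inj j k x : cell_bump j x != 0 -> cell_bump k x != 0 -> j = k.
Proof.
have in_cell i : cell_bump i x != 0 -> left_end i < x < left_end i + width.
  move=> bi; apply: contrapT => /cell_bump_outside[b0 _ _].
  by move: bi; rewrite b0 eqxx.
by move=> /in_cell xj /in_cell; exact: cells_disjoint xj.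
Qed.

(** The open cells are disjoint, so at most one term is nonzero at [x], and the bound does not grow
    with [N]. *)
Lemma norm_sum_cells (f : 'I_N -> R) J x (M : R) : 0 <= M ->
  (forall j, `|f j| <= M) ->
  (forall j, ~ left_end j < x < left_end j + width -> f j = 0) ->
  `|\sum_(j in J) f j| <= M.
Proof.
move=> M0 fM f0; case: (pickP (fun j => (j \in J) && (f j != 0))) => [j /andP[jJ fj]|none].
  rewrite (bigD1 j)//= big1 ?addr0// => k /andP[kJ kj].
  apply: (f0 k) => xk; move/eqP: kj; apply; apply: (cells_disjoint xk).
  by apply: contrapT => /f0 fj0; move: fj; rewrite fj0 eqxx.
rewrite big1 ?normr0// => j jJ; apply/eqP.
by have := none j; rewrite jJ/= => /negbFE.
Qed.

Lemma is_derive1_sum (I : Type) (r : seq I) (P : pred I) (f : I -> R -> R)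
    (d : I -> R) x : (forall i : I, is_derive x 1 (f i) (d i)) ->
  is_derive x 1 (fun y => \sum_(i <- r | P i) f i y) (\sum_(i <- r | P i) d i).
Proof.
move=> df; elim: r => [|i r IH].
  rewrite big_nil (_ : (fun _ => _) = fun=> 0); first exact: is_derive1_cst.
  by apply/funext => y; rewrite big_nil.
rewrite big_cons; case: ifPn => Pi.
  rewrite (_ : (fun _ => _) = fun y => f i y + \sum_(j <- r | P j) f j y).
    exact: is_derive1_add.
  by apply/funext => y; rewrite big_cons Pi.
rewrite (_ : (fun _ => _) = fun y => \sum_(j <- r | P j) f j y)//.
by apply/funext => y; rewrite big_cons (negbTE Pi).
Qed.

Lemma continuous_sum (I : Type) (r : seq I) (P : pred I) (f : I -> R -> R) :
  (forall i : I, continuous (f i)) -> continuous (fun y => \sum_(i <- r | P i) f i y).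
Proof.
move=> cf; elim: r => [|i r IH].
  rewrite (_ : (fun _ => _) = fun=> 0); first by move=> x; exact: cvg_cst.
  by apply/funext => y; rewrite big_nil.
have [Pi|Pi] := boolP (P i).
  rewrite (_ : (fun _ => _) = fun y => f i y + \sum_(j <- r | P j) f j y).
    by move=> x; apply: cvgD; [exact: cf|exact: IH].
  by apply/funext => y; rewrite big_cons Pi.
rewrite (_ : (fun _ => _) = fun y => \sum_(j <- r | P j) f j y)//.
by apply/funext => y; rewrite big_cons (negbTE Pi).
Qed.

Lemma is_derive_bumps J x :
  is_derive x 1 (bumps J) (\sum_(j in J) cell_bump' j x).
Proof. by apply: is_derive1_sum => j; exact: is_derive_cell_bump. Qed.

Lemma bumps_continuous J : continuous (bumps J).
Proof. by move=> x; exact: is_derive_continuous (is_derive_bumps J x). Qed.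

Lemma cell_bump_ge0 j x : 0 <= cell_bump j x.
Proof. by rewrite mulr_ge0 ?c2bump_ge0// divr_ge0// sqr_ge0. Qed.

Lemma bumps_ge0 J x : 0 <= bumps J x.
Proof. by apply: sumr_ge0 => j _; exact: cell_bump_ge0. Qed.

Lemma norm_bumps J x : `|bumps J x| <= 1 / 100.
Proof.
have w0 := width_gt0; have w2 := width_le.
apply: (@norm_sum_cells _ J x) => [|j|j out]; [lra| |by have [] := cell_bump_outside out].
have [b _ _] := c2bump_bounds (cell_coord j x).
apply: (@le_trans _ _ (1 / 8 * (1 / 64))); last lra.
by apply: normM_le b; rewrite ger0_norm; [nra|rewrite divr_ge0// sqr_ge0].
Qed.

Lemma potential_classQ J : classQ (potential J).
Proof.
have w0 := width_gt0; have w2 := width_le.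
exists (fun x => \sum_(j in J) cell_bump' j x), (fun x => \sum_(j in J) cell_bump'' j x).
split; first split.
- apply: is_derive_deriv01 => x _; rewrite -[X in is_derive _ _ _ X]add0r.
  by apply: is_derive1_add (is_derive1_cst _ _) (is_derive_bumps J x).
- by apply: is_derive_deriv01 => x _; apply: is_derive1_sum => j; exact: is_derive_cell_bump'.
- by apply: continuous_subspaceT; apply: continuous_sum => j; exact: cell_bump''_continuous.
move=> x _; split.
- rewrite /potential; have := norm_bumps J x; have := bumps_ge0 J x.
  by rewrite ler_norml; lra.
- apply: (@norm_sum_cells _ J x) => [|j|j out]; [lra| |by have [] := cell_bump_outside out].
  have [_ b _] := c2bump_bounds (cell_coord j x).
  apply: (@le_trans _ _ (1 / 4 * 1)); last lra.
  by apply: normM_le b; rewrite ger0_norm; lra.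
- apply: (@norm_sum_cells _ J x) => [|j|j out]; [lra| |by have [] := cell_bump_outside out].
  have [_ _ b] := c2bump_bounds (cell_coord j x).
  apply: (@le_trans _ _ (1 / 2 * 2)); last lra.
  by apply: normM_le b; rewrite ger0_norm; lra.
Qed.

(** The quantity r (t - s) / 8 of [lambda_gap] for the middle half of a cell: t - s = width / 2 and
    r = width^2 / 320. *)
Definition gap : R := width ^+ 3 / (64 * 80).

Lemma lambda_potential_step j J : j \notin J ->
  lambda (potential J) + gap <= lambda (potential (j |: J)).
Proof.
move=> jJ; have w0 := width_gt0; have w2 := width_le.
have bumpsU x : bumps (j |: J) x = cell_bump j x + bumps J x.
  by rewrite /bumps big_setU1.
have jN : j%:R * width + width <= 1 / 2.
  by rewrite -width_card -[X in _ + X]mul1r -mulrDl ler_wpM2r ?natr1 ?ler_nat// ltW.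
have j0 : 0 <= j%:R * width by rewrite mulr_ge0// ltW.
pose s := left_end j + width / 4; pose t := left_end j + 3 * width / 4.
have mono x : bumps J x <= bumps (j |: J) x by rewrite bumpsU lerDr cell_bump_ge0.
have s14 : 1 / 4 <= s by rewrite /s /left_end; lra.
have st : s < t by rewrite /s /t; lra.
have t34 : t <= 3 / 4 by rewrite /t /left_end; lra.
have r0 : 0 < width ^+ 2 / 320 by rewrite divr_gt0 ?exprn_gt0 ?ltr0n.
have ge x : s < x < t -> width ^+ 2 / 320 <= bumps (j |: J) x - bumps J x.
  move=> /andP[sx xt]; rewrite bumpsU addrK.
  have -> : width ^+ 2 / 320 = width ^+ 2 / 2 * (1 / 160) by field.
  apply: ler_wpM2l; first by rewrite divr_ge0// sqr_ge0.
  apply: c2bump_ge; move: w0 sx xt; rewrite /s /t /cell_coord.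
  move: (width) (left_end j) => w l w0 sx xt.
  by rewrite ler_pdivlMr// ler_pdivrMr//; lra.
apply: le_trans (lambda_gap (bumps_continuous (J := J)) (bumps_continuous (J := j |: J))
  (norm_bumps J) (norm_bumps (j |: J)) mono s14 st t34 r0 ge).
rewrite /potential lerD2l /gap /s /t.
by rewrite le_eqVlt; apply/orP; left; apply/eqP; field.
Qed.

Lemma lambda_potential_card J :
  lambda (potential finset.set0) + #|J|%:R * gap <= lambda (potential J).
Proof.
have [n] := ubnP #|J|; elim: n J => // n IH J Jn.
have [->|[j jJ]] := set_0Vmem J; first by rewrite cards0 mul0r addr0.
have := lambda_potential_step (J := J :\ j) (j := j); rewrite !inE eqxx finset.setD1K//= => /(_ erefl).
have /IH : (#|J :\ j| < n)%N by move: Jn; rewrite (cardsD1 j) jJ add1n ltnS.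
by rewrite (cardsD1 j J) jJ add1n -natr1; lra.
Qed.

End Family.

(** * Algorithms on the fooling family *)

Section Runs.
Context {R : realType}.
Variable A : algorithm R.
Implicit Types (q : R -> R) (i n : nat).

Lemma nvaluesP q : classQ q -> stop A (history (Defs.point A) q (nvalues A q)) /\
  forall m, (m < nvalues A q)%N -> ~~ stop A (history (Defs.point A) q m).
Proof.
move=> /(stopP A) ex_stop; rewrite /nvalues; case: xgetP => [n _ []//|none].
have [n stop_n min_n] := ex_minnP ex_stop; case: (none n); split => // m.
by apply: contraTN => /min_n; rewrite leqNgt.
Qed.

Lemma eq_history q q' n :
  (forall i, (i < n)%N -> q (node A q i) = q' (node A q i)) ->
  forall i, (i <= n)%N -> history (Defs.point A) q' i = history (Defs.point A) q i.
Proof.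
move=> qq'; elim=> [//|i IH] lt_in /=.
by rewrite IH ?(ltnW lt_in)// -(qq' i lt_in).
Qed.

(** The histories coincide up to the stopping time of [q], so neither run can stop before the
    other. *)
Lemma eq_run q q' : classQ q -> classQ q' ->
  (forall i, (i < nvalues A q)%N -> q (node A q i) = q' (node A q i)) ->
  [/\ nvalues A q' = nvalues A q, answer A q' = answer A q
    & forall i, (i < nvalues A q)%N -> node A q' i = node A q i].
Proof.
move=> Qq Qq' qq'; have hist := eq_history qq'.
have [stop_q go_q] := nvaluesP Qq; have [stop_q' go_q'] := nvaluesP Qq'.
have nE : nvalues A q' = nvalues A q.
  case: (ltngtP (nvalues A q') (nvalues A q)) => // lt_n.
    by have := go_q _ lt_n; rewrite -hist ?(ltnW lt_n)// stop_q'.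
  by have := go_q' _ lt_n; rewrite hist// stop_q.
split => [//||i lt_i]; first by rewrite /answer nE hist.
by rewrite /node hist// ltnW.
Qed.

End Runs.

(** * Variance of functions of hidden bits *)

Section Flip.
Variable N : nat.
Implicit Types (J K : {set 'I_N}) (j k : 'I_N).

Definition flip j J : {set 'I_N} := if j \in J then (J :\ j)%SET else (j |: J)%SET.

Lemma in_flip j k J : (k \in flip j J) = (k \in J) (+) (k == j).
Proof.
rewrite /flip; case: ifP => jJ; rewrite !inE.
  by have [->|] := eqVneq k j; rewrite ?jJ//= addbF.
by have [->|] := eqVneq k j; rewrite ?jJ//= addbF.
Qed.

Lemma flipK j : involutive (flip j).
Proof. by move=> J; apply/setP => k; rewrite !in_flip -addbA addbb addbF. Qed.

Lemma flip_inj j : injective (flip j).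
Proof. exact: inv_inj (flipK j). Qed.

Section Variance.
Variables (R : realFieldType) (f a : {set 'I_N} -> R) (V : {set 'I_N} -> {set 'I_N}).
Variable d : R.
Hypothesis d0 : 0 <= d.
Hypothesis V_flip : forall j J, j \notin V J -> V (flip j J) = V J.
Hypothesis a_flip : forall j J, j \notin V J -> a (flip j J) = a J.
Hypothesis f_step : forall j J, j \notin J -> f J + d <= f (j |: J)%SET.

Definition sign j J : R := if j \in J then 1 else -1.

(** A fair sign, set to 0 once its coordinate is seen; under uniform [J] these variables are
    pairwise orthogonal. *)
Definition hidden_sign j J : R := if j \in V J then 0 else sign j J.

Lemma sign_flip j k J : sign k (flip j J) = if k == j then - sign k J else sign k J.
Proof.
by rewrite /sign in_flip; case: eqVneq => _; case: (k \in J); rewrite //= opprK.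
Qed.

Lemma in_V_flip j J : (j \in V (flip j J)) = (j \in V J).
Proof.
apply/idP/idP; apply: contraTT => jV; first by rewrite V_flip.
by rewrite -(flipK j J) V_flip.
Qed.

Lemma sum_flip j (F : {set 'I_N} -> R) : \sum_J F (flip j J) = \sum_J F J.
Proof. by rewrite [RHS](reindex_inj (@flip_inj j)). Qed.

Lemma f_flip j J : d <= sign j J * (f J - f (flip j J)).
Proof.
rewrite /sign /flip; case: ifPn => jJ.
  have := @f_step j (J :\ j)%SET; rewrite !inE eqxx finset.setD1K// => /(_ erefl); lra.
by have := f_step jJ; lra.
Qed.

(** Pair [J] with [flip j J]: when j is hidden the two signs are opposite, the answer cancels and
    [f] contributes at least [d]. *)
Lemma sum_hidden_sign j :
  d / 2 * \sum_J (j \notin V J)%:R <= \sum_J (f J - a J) * hidden_sign j J.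
Proof.
set F := fun J => (f J - a J) * hidden_sign j J.
have -> : \sum_J F J = (\sum_J (F J + F (flip j J))) / 2.
  by rewrite big_split/= sum_flip; field.
rewrite mulrAC ler_wpM2r// mulr_sumr; apply: ler_sum => J _.
rewrite /F /hidden_sign in_V_flip; case: ifPn => jV; first by rewrite !mulr0 addr0.
by rewrite a_flip// sign_flip eqxx mulr1; have := f_flip j J; lra.
Qed.

(** For distinct j and k, flipping j negates the product, so its sum equals its own negative. *)
Lemma sum_hidden_sign2 j k :
  \sum_J hidden_sign j J * hidden_sign k J
  = if j == k then \sum_J (j \notin V J)%:R else 0.
Proof.
case: eqVneq => [<-|jk].
  apply: eq_bigr => J _; rewrite /hidden_sign /sign.
  by case: (j \in V J); case: (j \in J); rewrite ?mulr0 ?mulr1 ?mulN1r ?opprK.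
set F := fun J => hidden_sign j J * hidden_sign k J.
have FN J : F (flip j J) = - F J.
  rewrite /F /hidden_sign in_V_flip; case: ifPn => jV; first by rewrite !mul0r oppr0.
  by rewrite V_flip// !sign_flip eqxx eq_sym (negbTE jk) mulNr.
have : \sum_J F J = - \sum_J F J.
  by rewrite -[LHS](sum_flip j) -sumrN; apply: eq_bigr => J _; rewrite FN.
by rewrite /F; lra.
Qed.

(* Testing the error f - a against the sum g of the signs of the coordinates
   outside V: (f - a)^2 >= 2 t (f - a) g - t^2 g^2 with t = d / 2. *)
Lemma sum_sqr_error : d ^+ 2 / 4 * \sum_J #|(~: V J)%SET|%:R <= \sum_J (f J - a J) ^+ 2.
Proof.
pose g J := \sum_j hidden_sign j J.
pose S := \sum_j \sum_J ((j \notin V J)%:R : R).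
have SE : S = \sum_J #|(~: V J)%SET|%:R.
  rewrite /S exchange_big/=; apply: eq_bigr => J _.
  rewrite -sum1_card natr_sum [RHS]big_mkcond/=.
  by apply: eq_bigr => j _; rewrite inE; case: (j \in V J).
have cross : d / 2 * S <= \sum_J (f J - a J) * g J.
  rewrite /S mulr_sumr; under [leRHS]eq_bigr do rewrite mulr_sumr.
  by rewrite exchange_big/=; apply: ler_sum => j _; exact: sum_hidden_sign.
have square : \sum_J g J ^+ 2 = S.
  under eq_bigr do rewrite expr2 mulr_suml.
  rewrite exchange_big/=; apply: eq_bigr => j _.
  under eq_bigr do rewrite mulr_sumr.
  rewrite exchange_big/= (bigD1 j)//= [X in _ + X]big1 ?addr0.
    by rewrite sum_hidden_sign2 eqxx.
  by move=> k kj; rewrite sum_hidden_sign2 eq_sym (negbTE kj).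
have low J : d * ((f J - a J) * g J) - d ^+ 2 / 4 * g J ^+ 2 <= (f J - a J) ^+ 2.
  have := sqr_ge0 (f J - a J - d / 2 * g J); lra.
have /= := ler_sum (index_enum _) (fun J (_ : xpredT J) => low J).
rewrite sumrB -!mulr_sumr square -SE.
by have := @ler_wpM2l _ d d0 _ _ cross; lra.
Qed.

End Variance.
End Flip.

(** * Bumps left unseen by an algorithm *)

Section Hiding.
Context {R : realType}.
Variable N : nat.
Hypothesis N0 : (0 < N)%N.
Variable A : algorithm R.
Implicit Types (J K : {set 'I_N}) (j : 'I_N).

(** A cell counts only if its bump is nonzero at some node, since only then do the computed values
    depend on it. *)
Definition visited J : {set 'I_N} :=
  [set j | [exists i : 'I_(nvalues A (@potential R N J)),
     cell_bump j (node A (@potential R N J) i) != 0]]%SET.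

Lemma card_visited J : (#|visited J| <= nvalues A (@potential R N J))%N.
Proof.
set n := nvalues _ _.
(* Disjointness leaves each node at most one cell, so the visited cells lie in the image of this
   partial map on nodes. *)
pose cell (i : 'I_n) := [pick j : 'I_N | cell_bump j (node A (@potential R N J) i) != 0].
rewrite -[n]card_ord -cardsT -(card_imset _ (@Some_inj _)).
apply: leq_trans (leq_imset_card cell _); apply: subset_leq_card.
apply/fintype.subsetP => _ /imsetP[j + ->]; rewrite inE => /existsP[i ji].
apply/imsetP; exists i => //; rewrite /cell.
case: pickP => [k ki|/(_ j)]; last by rewrite ji.
by rewrite (cell_bump_inj N0 ji ki).
Qed.

Lemma eq_potential J K (x : R) :
  (forall j, cell_bump j x != 0 -> (j \in J) = (j \in K)) ->
  potential J x = potential K x.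
Proof.
move=> JK; rewrite /potential /bumps [in LHS]big_mkcond [in RHS]big_mkcond/=.
congr (_ + _); apply: eq_bigr => j _.
have [->|/JK ->//] := eqVneq (cell_bump j x) 0.
by rewrite !if_same.
Qed.

(** Unvisited bumps vanish at every node of the run on [potential J], so both potentials return the
    same values there. *)
Lemma same_visited J K : (forall j, j \in visited J -> (j \in J) = (j \in K)) ->
  [/\ nvalues A (@potential R N K) = nvalues A (@potential R N J),
      answer A (@potential R N K) = answer A (@potential R N J)
    & visited K = visited J].
Proof.
move=> JK; have [nE aE nodeE] : [/\ nvalues A (@potential R N K) = nvalues A (@potential R N J),
    answer A (@potential R N K) = answer A (@potential R N J)
    & forall i, (i < nvalues A (@potential R N J))%N ->
        node A (@potential R N K) i = node A (@potential R N J) i].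
  apply: eq_run; [exact: potential_classQ|exact: potential_classQ|move=> i lt_i].
  apply: eq_potential => j ji; apply: JK; rewrite inE.
  by apply/existsP; exists (Ordinal lt_i).
split => //; apply/setP => j; rewrite !inE.
apply/existsP/existsP => -[i ji].
  have lt_i : (i < nvalues A (@potential R N J))%N by rewrite -nE.
  by exists (Ordinal lt_i); rewrite /= -nodeE.
have lt_i : (i < nvalues A (@potential R N K))%N by rewrite nE.
by exists (Ordinal lt_i); rewrite /= nodeE.
Qed.

Lemma flip_visited j J : j \notin visited J ->
  answer A (@potential R N (flip j J)) = answer A (@potential R N J) /\
  visited (flip j J) = visited J.
Proof.
move=> jV; have [k kV|_ -> ->//] := @same_visited J (flip j J).
by rewrite in_flip; case: eqVneq kV jV => [->->|]//; rewrite addbF.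
Qed.

Lemma gap_gt0 : 0 < @gap R N.
Proof. by rewrite divr_gt0 ?exprn_gt0 ?width_gt0// mulr_gt0. Qed.

(** The fooling set consists of all bumps missed on the constant potential: the answer stays the
    same while the eigenvalue rises by at least [gap] per missed bump. *)
Lemma worst_case_error (eps : R) :
  (forall q, classQ q -> `|lambda q - answer A q| <= eps) ->
  (N%:R - (nvalues A (@potential R N finset.set0))%:R) * @gap R N <= 2 * eps.
Proof.
move=> err; pose J := (~: visited finset.set0)%SET.
have [|_ aE _] := @same_visited finset.set0 J.
  by move=> j jV; rewrite finset.in_setC finset.in_set0 jV.
have := err _ (potential_classQ N0 J); have := err _ (potential_classQ N0 finset.set0).
rewrite aE => e0 e1; have g0 := gap_gt0.
have := @lambda_potential_card R N N0 J.
have : (N%:R - (nvalues A (@potential R N finset.set0))%:R) * @gap R N <= #|J|%:R * @gap R N.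
  rewrite ler_wpM2r ?(ltW g0)// lerBlDr -natrD ler_nat.
  have NE := cardsC (visited finset.set0); rewrite card_ord in NE.
  apply: leq_trans (eq_leq (esym NE)) _.
  by rewrite addnC leq_add2l card_visited.
by move: e0 e1; rewrite !ler_norml; lra.
Qed.

(** [sum_sqr_error] with at least N - nvalues hidden bumps for each [J]. The cost is moved to the
    right so that the bound is a sum of nonnegative terms, ready for integration. *)
Lemma mean_square_error :
  @gap R N ^+ 2 / 4 * (#|{set 'I_N}|%:R * N%:R) <=
  \sum_(J : {set 'I_N}) (lambda (@potential R N J) - answer A (@potential R N J)) ^+ 2 +
  @gap R N ^+ 2 / 4 * \sum_(J : {set 'I_N}) (nvalues A (@potential R N J))%:R.
Proof.
have V_flip j J : j \notin visited J -> visited (flip j J) = visited J.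
  by move=> /flip_visited[].
have a_flip j J : j \notin visited J ->
    answer A (@potential R N (flip j J)) = answer A (@potential R N J).
  by move=> /flip_visited[].
have := sum_sqr_error (f := fun J => lambda (@potential R N J)) (ltW gap_gt0)
  V_flip a_flip (lambda_potential_step N0).
set X := \sum_J (_ - _) ^+ 2 => low.
rewrite -lerBlDr -mulrBr; apply: le_trans low.
apply: ler_wpM2l; first by rewrite divr_ge0// sqr_ge0.
have -> : #|{set 'I_N}|%:R * N%:R = \sum_(J : {set 'I_N}) (N%:R : R).
  by rewrite sumr_const mulr_natl.
rewrite -sumrB; apply: ler_sum => J _.
rewrite lerBlDr -natrD ler_nat.
have NE := cardsC (visited J); rewrite card_ord in NE.
apply: leq_trans (eq_leq (esym NE)) _.
by rewrite addnC leq_add2l card_visited.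
Qed.

End Hiding.

(** * Rates *)

Section Rates.
Context {R : realType}.

(** [N] is the integer part of X = c0 eps^(-a/b), for which eps^a X^b = c0^b; c0 = min(1, K) ensures
    c0^b <= K. *)
Lemma cells_for_rate (a b : nat) (K : R) : (0 < a)%N -> (0 < b)%N -> 0 < K ->
  exists2 c : R, 0 < c & \forall eps \near 0^'+, exists N : nat,
    [/\ (0 < N)%N, eps ^+ a * N%:R ^+ b <= K &
        c * eps `^ (- (a%:R / b%:R)) <= N%:R / 2].
Proof.
move=> a0 b0 K0; pose c0 := Num.min 1 K.
have c00 : 0 < c0 by rewrite lt_min ltr01.
have c01 : c0 <= 1 by rewrite ge_min lexx.
have c0K : c0 <= K by rewrite ge_min lexx orbT.
have c0b0 : 0 < c0 ^+ b by rewrite exprn_gt0.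
have c0b : c0 ^+ b <= c0.
  by rewrite -[leRHS]expr1 ler_wiXn2l// ltW.
exists (c0 / 4); first by rewrite divr_gt0.
near=> eps.
have e0 : 0 < eps by near: eps; exact: nbhs_right_gt.
have eb : eps < c0 ^+ b by near: eps; exact: nbhs_right_lt.
pose X := c0 * eps `^ (- (a%:R / b%:R)).
have XbE : eps ^+ a * X ^+ b = c0 ^+ b.
  rewrite exprMn -(powR_mulrn b (powR_ge0 _ _)) -powRrM.
  have -> : - (a%:R / b%:R) * b%:R = - a%:R :> R.
    by rewrite mulNr divfK// pnatr_eq0 -lt0n.
  rewrite powR_invn ?(ltW e0)// mulrCA mulfV ?mulr1//.
  by rewrite expf_neq0// gt_eqF.
have X0 : 0 <= X by rewrite mulr_ge0 ?powR_ge0// ltW.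
(* Otherwise c0^b = eps^a X^b <= eps^a <= eps, against the choice of eps. *)
have X1 : 1 <= X.
  rewrite leNgt; apply/negP => X1.
  have : eps ^+ a * X ^+ b <= eps ^+ a * 1.
    by rewrite ler_wpM2l ?exprn_ge0 ?(ltW e0)// exprn_ile1// ltW.
  rewrite XbE mulr1; apply/negP; rewrite -ltNge.
  apply: le_lt_trans eb; rewrite -[leRHS]expr1 ler_wiXn2l ?(ltW e0)//.
  by rewrite ltW// (lt_le_trans eb)// (le_trans c0b).
have /andP[NX XN] := truncn_itv X0.
exists (Num.truncn X); have N0 : (0 < Num.truncn X)%N by rewrite truncn_gt_nat.
split => //.
  apply: le_trans (le_trans c0b c0K); rewrite -XbE.
  by rewrite ler_wpM2l ?exprn_ge0 ?(ltW e0)// lerXn2r// nnegrE.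
(* From N >= 1 follows X < N + 1 <= 2N, hence X / 4 <= N / 2; this is the 4 in the constant. *)
have : 1 <= (Num.truncn X)%:R :> R by rewrite ler1n.
move: XN; rewrite -natr1 => XN N1.
by rewrite mulrAC -/X; lra.
Unshelve. all: by end_near. Qed.

End Rates.

(** * The worst case lower bound *)

Section WorstCase.
Context {R : realType}.

Lemma cost_wor_ge (N : nat) (A : algorithm R) (eps : R) : (0 < N)%N ->
  (err_wor A <= eps%:E)%E -> eps ^+ 1 * N%:R ^+ 2 <= (1 / 1000) ^+ 2 ->
  ((N%:R / 2)%:E <= cost_wor A)%E.
Proof.
move=> N0 err epsN.
have errq q : classQ q -> `|lambda q - answer A q| <= eps.
  move=> Qq; rewrite -lee_fin; apply: le_trans err.
  by apply: ereal_sup_ubound; exists q.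
have := worst_case_error N0 errq.
set n := nvalues A _ => main.
have : ((n%:R : R)%:E <= cost_wor A)%E.
  by apply: ereal_sup_ubound; exists (@potential R N finset.set0) => //; exact: potential_classQ.
apply: le_trans; rewrite lee_fin.
have N1 : 0 < (N%:R : R) by rewrite ltr0n.
(* Dividing by [gap] gives N - n <= 81920 eps N^3, which is below N / 2 once eps N^2 <= 10^-6. *)
have gapE : @gap R N * (8 * 64 * 80 * N%:R ^+ 3) = 1.
  by rewrite /gap /width; field; rewrite gt_eqF.
have : (N%:R - n%:R) <= 2 * eps * (8 * 64 * 80 * N%:R ^+ 3).
  have K0 : 0 <= 8 * 64 * 80 * (N%:R : R) ^+ 3 by rewrite !mulr_ge0// exprn_ge0// ltW.
  by have := ler_wpM2r K0 main; rewrite -[X in X <= _ -> _]mulrA gapE mulr1.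
have : eps ^+ 1 * N%:R ^+ 2 * N%:R <= (1 / 1000) ^+ 2 * N%:R.
  by rewrite ler_wpM2r// ltW.
by rewrite expr1; move: (N%:R : R) N1 => x N1; lra.
Qed.

End WorstCase.

(** * The randomized lower bound *)

Section Randomized.
Context {R : realType} d (T : measurableType d) (P : probability T R).
Variable A : ran_algorithm R T.

Lemma err_ran_sqr (eps : R) q : (err_ran P A <= eps%:E)%E -> classQ q ->
  (\int[P]_w ((lambda q - answer (A w) q) ^+ 2)%:E <= (eps ^+ 2)%:E)%E.
Proof.
move=> err Qq; have : ('E_P[fun w => ((lambda q - answer (A w) q) ^+ 2)%R] `^ 2^-1 <= eps%:E)%E.
  by apply: le_trans err; apply: ereal_sup_ubound; exists q.
rewrite unlock.
have : (0 <= \int[P]_w ((lambda q - answer (A w) q) ^+ 2)%:E)%E.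
  by apply: integral_ge0 => w _; rewrite lee_fin sqr_ge0.
case: (\int[P]_w _)%E => [r| |]//.
  rewrite !lee_fin => r0; rewrite powR12_sqrt// => re.
  rewrite -(sqr_sqrtr r0) lerXn2r// nnegrE ?sqrtr_ge0//.
  exact: le_trans (sqrtr_ge0 _) re.
(* An infinite mean square would have an infinite root, exceeding the finite [eps]. *)
by rewrite poweRyr// invr_eq0.
Qed.

(** [mean_square_error] holds for each outcome [w]; integrating it and exchanging the integral with
    the sum over [J] bounds the average over [J] by the two suprema. *)
Lemma cost_ran_ge (N : nat) (eps : R) : (0 < N)%N ->
  (cost_ran P A < +oo)%E -> (err_ran P A <= eps%:E)%E ->
  eps ^+ 2 * N%:R ^+ 5 <= (1 / 1000) ^+ 4 ->
  ((N%:R / 2)%:E <= cost_ran P A)%E.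
Proof.
move=> N0 cost_fin err epsN.
have costq q : classQ q -> (\int[P]_w ((nvalues (A w) q)%:R)%:E <= cost_ran P A)%E.
  by move=> Qq; apply: ereal_sup_ubound; exists q => //; rewrite unlock.
have QJ J := @potential_classQ R N N0 J.
have cost0 : (0 <= cost_ran P A)%E.
  apply: le_trans (costq _ (QJ finset.set0)).
  by apply: integral_ge0 => w _; rewrite lee_fin.
move: cost_fin costq cost0; case: (cost_ran P A) => [C| |]// _ costq; rewrite lee_fin => C0.
rewrite lee_fin; pose g : R := @gap R N ^+ 2 / 4.
have g0 : 0 <= g by rewrite divr_ge0// sqr_ge0.
pose h (J : {set 'I_N}) w : R := (lambda (@potential R N J) - answer (A w) (@potential R N J)) ^+ 2
  + g * (nvalues (A w) (@potential R N J))%:R.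
have msq J : measurable_fun [set: T]
    (fun w => (lambda (@potential R N J) - answer (A w) (@potential R N J)) ^+ 2).
  apply: measurable_funX; apply: measurable_funB => //.
  exact: measurable_answer.
have mn J : measurable_fun [set: T]
    (fun w => (nvalues (A w) (@potential R N J))%:R : R).
  apply: (@measurableT_comp _ _ _ _ _ _ (fun n : nat => n%:R : R)) => //.
  exact: measurable_nvalues.
have mh J : measurable_fun [set: T] (h J).
  by apply: measurable_funD => //; apply: measurable_funM.
have hint J : (\int[P]_w (h J w)%:E <= (eps ^+ 2 + g * C)%:E)%E.
  have s0 w : [set: T] w ->
      (0 <= ((lambda (@potential R N J) - answer (A w) (@potential R N J)) ^+ 2)%:E)%E.
    by rewrite lee_fin sqr_ge0.
  have n0 w : [set: T] w -> (0 <= ((nvalues (A w) (@potential R N J))%:R : R)%:E)%E.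
    by rewrite lee_fin.
  have gn0 w : [set: T] w -> (0 <= (g * (nvalues (A w) (@potential R N J))%:R)%:E)%E.
    by rewrite lee_fin mulr_ge0.
  have mgn : measurable_fun [set: T]
      (fun w => (g * (nvalues (A w) (@potential R N J))%:R : R)).
    exact: measurable_funM.
  under eq_integral do rewrite /h EFinD.
  have /measurable_EFinP ms := msq J; have /measurable_EFinP mgn' := mgn.
  have /measurable_EFinP mn' := mn J.
  rewrite (ge0_integralD P measurableT s0 ms gn0 mgn') EFinD leeD//.
    exact: err_ran_sqr.
  under eq_integral do rewrite EFinM.
  rewrite (ge0_integralZl_EFin P measurableT n0 mn' g0).
  by rewrite (EFinM g C) lee_wpmul2l ?lee_fin ?costq.
have low : ((g * (#|{set 'I_N}|%:R * N%:R))%:E <=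
    \sum_(J : {set 'I_N}) (eps ^+ 2 + g * C)%:E)%E.
  apply: (@le_trans _ _ (\int[P]_w (\sum_(J : {set 'I_N}) (h J w)%:E)))%E.
    have -> : ((g * (#|{set 'I_N}|%:R * N%:R))%:E =
        \int[P]_w (g * (#|{set 'I_N}|%:R * N%:R))%:E)%E.
      by rewrite integral_cst//= probability_setT mule1.
    apply: ge0_le_integral => //.
    - by move=> w _; rewrite lee_fin (mulr_ge0 g0)// mulr_ge0.
    - by apply: emeasurable_sum => J; exact/measurable_EFinP.
    - move=> w _; rewrite sumEFin lee_fin /h big_split/= -mulr_sumr.
      exact: mean_square_error.
  rewrite ge0_integral_sum//.
  - by apply: lee_sum => J _; exact: hint.
  - by move=> J; exact/measurable_EFinP.
  - by move=> J w _; rewrite lee_fin addr_ge0 ?sqr_ge0// mulr_ge0.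
move: low; rewrite sumEFin lee_fin sumr_const -[leRHS]mulr_natl mulrCA.
have M0 : 0 < (#|{set 'I_N}|%:R : R).
  by rewrite ltr0n; apply/card_gt0P; exists finset.set0.
rewrite ler_pM2l// => main.
have N1 : 0 < (N%:R : R) by rewrite ltr0n.
(* Dividing by [g] leaves N - C below about 6.8 * 10^9 eps^2 N^6, which is less than N / 2 once
   eps^2 N^5 <= 10^-12. *)
have gE : g * (4 * (8 * 64 * 80) ^+ 2 * N%:R ^+ 6) = 1.
  by rewrite /g /gap /width; field; rewrite gt_eqF.
have : N%:R - C <= eps ^+ 2 * (4 * (8 * 64 * 80) ^+ 2 * N%:R ^+ 6).
  have K0 : 0 <= 4 * (8 * 64 * 80) ^+ 2 * (N%:R : R) ^+ 6.
    by rewrite !mulr_ge0// exprn_ge0// ltW.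
  have main' : g * (N%:R - C) <= eps ^+ 2 by lra.
  by have := ler_wpM2r K0 main'; rewrite mulrAC gE mul1r.
have : eps ^+ 2 * N%:R ^+ 5 * N%:R <= (1 / 1000) ^+ 4 * N%:R.
  by rewrite ler_wpM2r// ltW.
by move: (N%:R : R) N1 => x N1; lra.
Qed.

End Randomized.

Theorem theorem4p1 (R : realType) :
  Omega_0 (@n_wor R) (fun eps => eps `^ (- (1 / 2))) /\
  Omega_0 (@n_ran R) (fun eps => eps `^ (- (2 / 5))).
Proof.
split.
  have K0 : 0 < (1 / 1000) ^+ 2 :> R by lra.
  (* The constraint eps N^2 <= K allows N of order eps^(-1/2). *)
  have [c c0 near_c] := cells_for_rate (isT : (0 < 1)%N) (isT : (0 < 2)%N) K0.
  exists c => //; apply: filterS near_c => eps [N [N0 epsN cN]].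
  apply: le_ereal_inf_tmp => _ [A [_ errA] <-].
  by apply: le_trans (cost_wor_ge N0 errA epsN); rewrite lee_fin; exact: cN.
have K0 : 0 < (1 / 1000) ^+ 4 :> R by lra.
(* The constraint eps^2 N^5 <= K allows N of order eps^(-2/5). *)
have [c c0 near_c] := cells_for_rate (isT : (0 < 2)%N) (isT : (0 < 5)%N) K0.
exists c => //; apply: filterS near_c => eps [N [N0 epsN cN]].
apply: le_ereal_inf_tmp => _ [d [T [P [A [costA errA ->]]]]].
by apply: le_trans (cost_ran_ge N0 costA errA epsN); rewrite lee_fin; exact: cN.
Qed.
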